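(* Let $k>n$ be positive integers, and let $\Omega$ be an open subset of $\mathbb{R}^k$. If $f\in W^{1,1}_{\mathrm{loc}}(\Omega;\mathbb{R}^{2n+1})$ satisfies the weak contact equation $$\operatorname{im}\,\operatorname{wk}df_x\subset\ker\alpha(f(x))\quad\text{for }\mathcal{H}^k\text{-almost every }x\in\Omega,$$ then for $\mathcal{H}^k$-almost every $x\in\Omega$, $$\mathrm{rank}\,\operatorname{wk}df_x\le n.$$
   Context: Points of $\mathbb{R}^{2n+1}$ are written $(x_1,y_1,\ldots,x_n,y_n,t)$. The standard contact form on $\mathbb{R}^{2n+1}$ is $\alpha=dt+2\sum_{j=1}^n(x_j\,dy_j-y_j\,dx_j)$, and $\ker\alpha(p)$ denotes its kernel at the point $p$, a $2n$-dimensional subspace of $\mathbb{R}^{2n+1}$. $W^{1,1}_{\mathrm{loc}}(\Omega;\mathbb{R}^{2n+1})$ is the Sobolev space of locally integrable mappings $f\colon\Omega\to\mathbb{R}^{2n+1}$ having a locally integrable weak derivative, denoted $\operatorname{wk}df$; $\operatorname{wk}df_x\colon\mathbb{R}^k\to\mathbb{R}^{2n+1}$ is its value at $x$. $\mathcal{H}^k$ is Lebesgue measure on $\mathbb{R}^k$. *)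

(* Defs.v *)
From HB Require Import structures.
From mathcomp Require Import all_boot all_order all_algebra.
From mathcomp Require Import all_classical all_reals all_analysis.

Set Implicit Arguments.
Unset Strict Implicit.
Unset Printing Implicit Defensive.

Import Order.TTheory GRing.Theory Num.Theory.
Import numFieldNormedType.Exports.

Local Open Scope classical_set_scope.
Local Open Scope ring_scope.

Section tuple_lebesgue.
Context {R : realType}.
Local Notation RT := (measurableTypeR R).

Definition tcons k (p : RT * k.-tuple RT) : k.+1.-tuple RT :=
  [tuple of p.1 :: p.2].

Lemma measurable_tcons k : measurable_fun setT (@tcons k).
Proof. exact: (measurable_cons measurable_fst measurable_snd). Qed.

Section step.
Variables (k : nat) (mu : {sigma_finite_measure set (k.-tuple RT) -> \bar R}).

Definition lebesgue_tcons : set (k.+1.-tuple RT) -> \bar R :=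
  pushforward (@lebesgue_measure R \x mu)%E (@tcons k).

Let pushforward_tcons : {measure set (k.+1.-tuple RT) -> \bar R} :=
  measure_function_pushforward__canonical__measure_function_Measure
    (@lebesgue_measure R \x mu)%E (@measurable_tcons k).

HB.instance Definition _ := Measure.copy lebesgue_tcons pushforward_tcons.

Lemma lebesgue_tcons_sigma_finite : sigma_finite setT lebesgue_tcons.
Proof.
have /sigma_finiteP[F [FT ndF mF]] := sigma_finiteT (@lebesgue_measure R).
have /sigma_finiteP[G [GT ndG mG]] := sigma_finiteT mu.
pose uncons (t : k.+1.-tuple RT) : RT * k.-tuple RT :=
  (thead t, [tuple of behead t]).
have tconsK : cancel (@tcons k) uncons.
  by move=> [x t]; congr pair; apply/val_inj.
have muncons : measurable_fun setT uncons.
  by apply/measurable_fun_pair; [exact: measurable_tnth|exact: measurable_behead].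
exists (fun i => uncons @^-1` (F i `*` G i)).
  rewrite -preimage_bigcup; apply/esym; rewrite -subTset => t _.
  have [i _ Fi] : (\bigcup_i F i) (uncons t).1 by rewrite -FT.
  have [j _ Gj] : (\bigcup_j G j) (uncons t).2 by rewrite -GT.
  exists (maxn i j) => //; split.
    by move: Fi; apply/subsetPset/ndF/leq_maxl.
  by move: Gj; apply/subsetPset/ndG/leq_maxr.
move=> i; have [mFi Fi] := mF i; have [mGi Gi] := mG i; split.
  by rewrite -[X in measurable X]setTI; apply: muncons => //; exact: measurableX.
rewrite /lebesgue_tcons /pushforward -comp_preimage.
have -> : uncons \o @tcons k = id by apply/funext => p; exact: tconsK.
rewrite preimage_id product_measure1E//.
by rewrite lte_mul_pinfty// ge0_fin_numE.
Qed.

HB.instance Definition _ :=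
  Measure_isSigmaFinite.Build _ _ _ lebesgue_tcons lebesgue_tcons_sigma_finite.

End step.

Lemma dirac_tuple0_sigma_finite :
  sigma_finite setT (@dirac _ (0.-tuple RT) [tuple] R).
Proof.
apply: fin_num_fun_sigma_finite; first by rewrite measure0.
by move=> A mA; rewrite diracE.
Qed.

HB.instance Definition _ := Measure_isSigmaFinite.Build _ _ _
  (@dirac _ (0.-tuple RT) [tuple] R) dirac_tuple0_sigma_finite.

(* The product of k copies of the Lebesgue measure of R, on the product
   sigma-algebra. *)
Fixpoint tuple_lebesgue (k : nat) :
    {sigma_finite_measure set (k.-tuple RT) -> \bar R} :=
  match k with
  | 0 => @dirac _ (0.-tuple RT) [tuple] R
  | k'.+1 => lebesgue_tcons (tuple_lebesgue k')
  end.

End tuple_lebesgue.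

Section lebesgue_rV.
Context {R : realType} {k : nat}.

Definition tuple_of_rV (x : 'rV[R]_k) : k.-tuple (measurableTypeR R) :=
  [tuple x 0 i | i < k].

(* The product measure lives on the product (Borel) sigma-algebra. Lebesgue
   measure on R^k is its completion, obtained by restricting the induced outer
   measure to its Caratheodory measurable sets, which are the Lebesgue
   measurable sets. *)
Definition lebesgue_outer (A : set 'rV[R]_k) : \bar R :=
  mu_ext (tuple_lebesgue k) (tuple_of_rV @` A).

Lemma lebesgue_outer0 : lebesgue_outer set0 = 0%E.
Proof. by rewrite /lebesgue_outer image_set0 mu_ext0. Qed.

Lemma lebesgue_outer_ge0 A : (0 <= lebesgue_outer A)%E.
Proof. exact: mu_ext_ge0. Qed.

Lemma le_lebesgue_outer : {homo lebesgue_outer : A B / A `<=` B >-> (A <= B)%E}.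
Proof. by move=> A B AB; apply/le_mu_ext/image_subset. Qed.

Lemma lebesgue_outer_sigma_subadditive : sigma_subadditive lebesgue_outer.
Proof.
by move=> A; rewrite /lebesgue_outer image_bigcup; exact: mu_ext_sigma_subadditive.
Qed.

HB.instance Definition _ := isOuterMeasure.Build R 'rV[R]_k lebesgue_outer
  lebesgue_outer0 lebesgue_outer_ge0 le_lebesgue_outer
  lebesgue_outer_sigma_subadditive.

Definition lebesgue_rV : set (caratheodory_type lebesgue_outer) -> \bar R :=
  lebesgue_outer.

HB.instance Definition _ := isMeasure.Build _ _ _ lebesgue_rV
  (caratheodory_measure0 _) (@caratheodory_measure_ge0 _ _ _)
  (@caratheodory_measure_sigma_additive _ _ _).

Lemma lebesgue_rVE (A : set (k.-tuple (measurableTypeR R))) : measurable A ->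
  measurable (tuple_of_rV @^-1` A : set (caratheodory_type lebesgue_outer)) /\
  lebesgue_rV (tuple_of_rV @^-1` A) = tuple_lebesgue k A.
Proof.
have imK (B : set (k.-tuple (measurableTypeR R))) :
    tuple_of_rV @` (tuple_of_rV @^-1` B) = B.
  apply: image_preimage; rewrite -subTset => t _.
  exists (\row_i tnth t i) => //; apply: eq_from_tnth => i.
  by rewrite tnth_mktuple mxE.
move=> mA; split; last by rewrite /lebesgue_rV /lebesgue_outer imK measurable_mu_extE.
move=> X.
have imI (B : set (k.-tuple (measurableTypeR R))) :
    tuple_of_rV @` (X `&` tuple_of_rV @^-1` B) = tuple_of_rV @` X `&` B.
  apply/seteqP; split => [_ [x [Xx Bx] <-]|_ [[x Xx <-] Bx]]; first by split => //; exists x.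
  by exists x.
have := @caratheodory_measurable_mu_ext _ _ _ (tuple_lebesgue k) _ mA
  (tuple_of_rV @` X).
by rewrite -!imI -preimage_setC.
Qed.

End lebesgue_rV.

Section sobolev.
Context {R : realType} {k : nat}.
Local Notation mu := (@lebesgue_rV R k).
Implicit Types (Omega : set 'rV[R]_k) (u phi : 'rV[R]_k -> R).

Definition partial (i : 'I_k) phi : 'rV[R]_k -> R :=
  fun x => 'D_(delta_mx 0 i) phi x.

Definition smooth phi := forall s : seq 'I_k,
  continuous (foldr partial phi s) /\
  forall i x, derivable (foldr partial phi s) x (delta_mx 0 i).

Definition closed_support phi : set 'rV[R]_k := closure [set x | phi x != 0].

Definition test_function Omega phi :=
  [/\ smooth phi, compact (closed_support phi) & closed_support phi `<=` Omega].

(* Not the library's locally_integrable, which is restricted to functions of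
   one real variable. *)
Definition locally_integrable_rV Omega u :=
  forall K, compact K -> K `<=` Omega -> mu.-integrable K (EFin \o u).

Definition weak_partial Omega (i : 'I_k) u v := forall phi,
  test_function Omega phi ->
  \int[mu]_(x in Omega) (u x * partial i phi x) =
  - \int[mu]_(x in Omega) (v x * phi x).

Section mappings.
Context {m : nat}.
Implicit Types (f : 'rV[R]_k -> 'rV[R]_m) (Df : 'rV[R]_k -> 'M[R]_(k, m)).

(* Points and tangent vectors are row vectors: [Df x] represents the linear map
   [v |-> v *m Df x] (as the library's [jacobian] does), so that its entry
   [(i, j)] is the [i]-th partial derivative of the [j]-th component. *)
Definition weak_derivative Omega f Df := forall i j,
  locally_integrable_rV Omega (fun x => Df x i j) /\
  weak_partial Omega i (fun x => f x 0 j) (fun x => Df x i j).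

Definition W11loc Omega f :=
  (forall j, locally_integrable_rV Omega (fun x => f x 0 j)) /\
  exists Df, weak_derivative Omega f Df.

End mappings.

End sobolev.

Section contact.
Context {R : realType} {n : nat}.
Implicit Types p v : 'rV[R]_(2 * n).+1.

(* Positions of x_j, y_j and t in (x_1, y_1, ..., x_n, y_n, t), with j counted
   from 0; both values given to inord are at most 2 * n, so it is exact. *)
Definition ix (j : 'I_n) : 'I_(2 * n).+1 := inord (2 * j).
Definition iy (j : 'I_n) : 'I_(2 * n).+1 := inord (2 * j).+1.
Definition it : 'I_(2 * n).+1 := ord_max.

Definition contact_form p v : R :=
  v 0 it + 2 * \sum_(j < n) (p 0 (ix j) * v 0 (iy j) - p 0 (iy j) * v 0 (ix j)).

Definition contact_kernel p : set 'rV[R]_(2 * n).+1 :=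
  [set v | contact_form p v = 0].

End contact.

(* Main.v *)
Require Import Defs.
From mathcomp Require Import all_boot all_order all_algebra.
From mathcomp Require Import all_classical all_reals all_analysis.
From mathcomp Require Import measurable_realfun zify ring lra.

Import Order.TTheory GRing.Theory Num.Theory.
Import numFieldNormedType.Exports.

Local Open Scope classical_set_scope.
Local Open Scope ring_scope.

Set Implicit Arguments.
Unset Strict Implicit.

(** Write x_j, y_j and t for the components of f. The contact equation reads
    dt = - 2 sum_j (x_j dy_j - y_j dx_j). For a smooth f, exterior derivation
    gives sum_j dx_j /\ dy_j = 0: the horizontal part of the derivative has an
    image that is isotropic for the standard symplectic form, hence of
    dimension at most n ([isotropic_rank]), and the contact equation expresses
    the component along t through the horizontal ones, so that it adds nothing
    to the rank ([contact_isotropic_rank]). The point is to obtain the isotropy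
    almost everywhere when f is only weakly differentiable and cannot be
    derived twice.

    The exterior derivative is replaced by its integral form: the contact
    equation is integrated around the boundary of the parallelogram with
    vertices x, x + r e_i, x + r e_i + r e_j, x + r e_j. For almost every x, f
    is along each of the four sides the integral of its weak partial derivative
    ([weak_difference], [ae_good_side]). The four increments of t add up to 0.
    Each of them is an integral of x_j dy_j - y_j dx_j, which [side_area]
    evaluates by replacing the partial derivatives by their values at x. If
    kappa is a bound for the integrals along the sides of the distance between
    the partial derivatives and their values at x, and M a bound for these
    values, then [loop_estimate] yields

      r^2 |sum_l dx_l /\ dy_l (e_i, e_j)| <= C (r M kappa + kappa^2)  at x.

    Translations are continuous in L^1 ([L1_shift_continuous]), so the integral
    over x of kappa / r tends to 0 with r ([integral_loop_osc_le]). Hence for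
    almost every x the ratio kappa / r becomes arbitrarily small for suitable
    r, and the form vanishes ([area_form_vanishes]).

    For [weak_difference], the weak derivative is tested against the integral
    over 0 <= sigma <= s of phi (y - x - sigma e_i), where phi is a product of
    bump functions of one variable. Its i-th partial derivative is a difference
    of two translates of phi, so the averages against phi of
    u (x) - u (x + s e_i) + integral of v (x + sigma e_i) vanish, and continuity
    of translations in L^1 turns this into vanishing almost everywhere
    ([ae0_of_averages]).

    All this concerns Borel functions on tuples with the product measure, where
    Fubini's theorem applies. The given mappings are only measurable for the
    completed measure; on a box inside the domain they agree almost everywhere
    with Borel functions ([borel_representative]), for which the weak
    derivatives persist ([weak_partial_on_box]). Countably many cubes cover the
    domain. *)

(** * Smooth functions of one variable and their products *)

Section smooth_algebra.
Context {R : realType}.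

(** The factors [y^-1 ^+ a] keep the family closed under derivation, up to
    linear combinations. *)
Definition flat (a : nat) (y : R) : R :=
  if 0 < y then y^-1 ^+ a * expR (- y^-1) else 0.

(** Every constructor preserves the existence of a derivative that belongs to
    the class again. Infinite differentiability of all members follows with no
    formula for a derivative of higher order. *)
Inductive smoothR : (R -> R) -> Prop :=
| smooth_flat a : smoothR (flat a)
| smooth_cst c : smoothR (cst c)
| smooth_add f g : smoothR f -> smoothR g -> smoothR (f \+ g)
| smooth_mul f g : smoothR f -> smoothR g -> smoothR (f \* g)
| smooth_affine f a b : smoothR f -> smoothR (fun x => f (a * x + b))
| smooth_primitive f g :
    smoothR g -> (forall x : R, is_derive x 1 f (g x)) -> smoothR f.

(** The exponential of [y^-1] dominates [(y^-1 / N) ^+ N] with [N = a + 2]. The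
    quadratic bound makes [flat a] differentiable at [0] with derivative [0]. *)
Lemma flat_le a (y : R) : `|flat a y| <= (a.+2)%:R ^+ a.+2 * y ^+ 2.
Proof.
rewrite /flat; case: ifPn => [y0|_]; last first.
  by rewrite normr0 mulr_ge0 ?sqr_ge0// exprn_ge0.
rewrite ger0_norm; last by rewrite mulr_ge0 ?expR_ge0// exprn_ge0// invr_ge0 ltW.
rewrite expRN.
set N := a.+2.
have N0 : 0 < N%:R :> R by rewrite ltr0n.
have le1 : (N%:R^-1 * y^-1) ^+ N <= expR y^-1.
  rewrite [in X in _ <= expR X](_ : y^-1 = N%:R * (N%:R^-1 * y^-1)); last first.
    by rewrite mulrA divff ?mul1r// gt_eqF.
  rewrite expRM_natl; apply: lerXn2r; rewrite ?nnegrE ?expR_ge0//.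
    by rewrite !mulr_ge0 ?invr_ge0// ltW.
  by apply: le_trans (expR_ge1Dx _); rewrite lerDr.
have p0 : 0 < (N%:R^-1 * y^-1) ^+ N by rewrite exprn_gt0// mulr_gt0// invr_gt0.
have : (expR y^-1)^-1 <= ((N%:R^-1 * y^-1) ^+ N)^-1.
  by rewrite lef_pV2// posrE expR_gt0.
move=> h; rewrite mulrC; apply: (@le_trans _ _ (((N%:R^-1 * y^-1) ^+ N)^-1 * y^-1 ^+ a)).
  rewrite ler_wpM2r//; first by rewrite exprn_ge0// invr_ge0 ltW.
rewrite -invfM !exprVn invrK exprMn -mulrA ler_pM2l ?exprn_gt0//.
by rewrite /N -addn2 exprD [y ^+ a * _]mulrC -mulrA divff ?mulr1// gt_eqF// exprn_gt0.
Qed.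

Lemma near_flat a (x : R) : x < 0 -> \forall y \near x, flat a y = 0.
Proof.
move=> x0; near=> y; rewrite /flat ifF//; apply/negbTE; rewrite -leNgt ltW//.
by near: y; exact: lt_nbhsl.
Unshelve. all: end_near. Qed.

Lemma is_derive_flat a (x : R) :
  is_derive x 1 (flat a) (- a%:R * flat a.+1 x + flat a.+2 x).
Proof.
have [x0|x0|->] := ltgtP x 0.
- rewrite [X in is_derive _ _ _ X](_ : _ = 0); last first.
    by rewrite /flat ltNge (ltW x0)/= mulr0 addr0.
  have E : {near x, cst 0 =1 flat a}.
    by have := near_flat a x0; apply: filterS => y /= ->.
  exact: (near_eq_is_derive E).
- have fE b : flat b x = x^-1 ^+ b * expR (- x^-1) by rewrite /flat x0.
  rewrite !fE.
  have E : {near x, (fun y => y^-1 ^+ a * expR (- y^-1)) =1 flat a}.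
    near=> y; rewrite /flat ifT//.
    by near: y; exact: lt_nbhsr.
  apply: (near_eq_is_derive E).
  have xN0 : x != 0 by rewrite gt_eqF.
  have d1 : is_derive x 1 (fun y : R => y^-1) (- x ^- 2).
    by have := @is_deriveV R id x 1 1 xN0 _; rewrite scaler1 /=; apply.
  have d2 : is_derive x 1 (fun y : R => expR (- y^-1)) (expR (- x^-1) * x ^- 2).
    have := @is_derive1_comp _ expR (fun y : R => - y^-1) x _ _ _ (is_deriveN d1).
    by rewrite opprK; apply.
  have d3 : is_derive x 1 (fun y : R => y^-1 ^+ a) (a%:R * x^-1 ^+ a.-1 * - x ^- 2).
    rewrite (_ : (fun y : R => y^-1 ^+ a) = (fun y : R => y^-1) ^+ a); last first.
      by apply/funext => y; rewrite exprfctE.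
    exact: is_deriveX.
  have := is_deriveM d3 d2.
  move/is_derive_eq; apply.
  rewrite /GRing.scale/=.
  by case: a E d3 => [|a] E d3; rewrite ?expr0 -?exprVn ?exprS; ring.
- rewrite [X in is_derive _ _ _ X](_ : _ = 0); last first.
    by rewrite /flat ltxx mulr0 addr0.
  have f00 : flat a 0 = 0 by rewrite /flat ltxx.
  set C : R := (a.+2)%:R ^+ a.+2.
  have C0 : 0 < C by rewrite exprn_gt0// ltr0n.
  have cv : (fun h => h^-1 *: ((flat a \o shift 0) (h *: 1) - flat a 0)) @ 0^' --> (0:R).
    apply/cvgrPdist_le => e e0; near=> h.
    have hN0 : h != 0 by near: h; exact: nbhs_dnbhs_neq.
    rewrite sub0r normrN /= f00 subr0 addr0 /GRing.scale/= mulr1 normrM normfV.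
    rewrite ler_pdivrMl ?normr_gt0//.
    apply: (le_trans (flat_le a h)); rewrite -real_normK ?num_real// -/C expr2 mulrA mulrC.
    rewrite ler_pM2l ?normr_gt0// -ler_pdivlMl//.
    near: h; apply: dnbhs0_le; by rewrite mulr_gt0// invr_gt0.
  by split; [apply/cvg_ex; exists 0|exact/cvg_lim].
Unshelve. all: end_near. Qed.

Lemma smoothR_derive f : smoothR f ->
  exists2 g, smoothR g & forall x : R, is_derive x 1 f (g x).
Proof.
elim=> {f} [a|c|f g _ [f' sf' df] _ [g' sg' dg]|f g sf [f' sf' df] sg [g' sg' dg]
           |f a b _ [f' sf' df]|f g sg _ df].
- exists (cst (- a%:R) \* flat a.+1 \+ flat a.+2).
    by apply: smooth_add; [apply: smooth_mul|]; constructor.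
  exact: is_derive_flat.
- by exists (cst 0); [constructor|move=> x; exact: is_derive_cst].
- exists (f' \+ g'); first exact: smooth_add.
  by move=> x; exact: is_deriveD.
- exists (f \* g' \+ g \* f'); first by apply: smooth_add; exact: smooth_mul.
  by move=> x; exact: is_deriveM.
- exists (fun x => a * f' (a * x + b)).
    by apply: (@smooth_mul (cst a)); [constructor|exact: smooth_affine].
  move=> x; have := @is_derive1_comp _ f (fun x => a * x + b) x (f' (a * x + b)) a (df _).
  rewrite mulrC; apply.
  have : is_derive x 1 (a \*: (@id R) + cst b) (a *: (1:R) + 0).
    by apply: is_deriveD.
  by rewrite addr0 /GRing.scale/= mulr1.
- by exists g.
Qed.

Lemma smoothR_continuous f : smoothR f -> continuous f.
Proof.
move=> /smoothR_derive[g _ df] x.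
have [dfx _] := df x.
exact/differentiable_continuous/derivable1_diffP.
Qed.

End smooth_algebra.

Section tensor.
Context {R : realType} {k : nat}.

Definition tensor (g : 'I_k -> R -> R) (x : 'rV[R]_k) : R := \prod_j g j (x 0 j).

Lemma continuous_tensor (g : 'I_k -> R -> R) :
  (forall j, continuous (g j)) -> continuous (tensor g).
Proof.
move=> cg.
suff cvg_prod (x : 'rV[R]_k) r :
    (fun y : 'rV[R]_k => \prod_(j <- r) g j (y 0 j)) @ x --> \prod_(j <- r) g j (x 0 j).
  by move=> x; exact: cvg_prod.
elim: r => [|j r IH].
  have -> : (fun y : 'rV[R]_k => \prod_(j <- [::]) g j (y 0 j)) = cst (1 : R).
    by apply/funext => y; rewrite big_nil.
  by rewrite big_nil; exact: (@cst_continuous _ _ (1 : R) x).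
rewrite (_ : (fun _ => _) = (fun y : 'rV[R]_k => g j (y 0 j)) \*
  (fun y => \prod_(j <- r) g j (y 0 j))); last first.
  by apply/funext => y; rewrite big_cons.
rewrite big_cons.
apply: (@continuousM _ _ _ _ x _ IH).
apply: (@continuous_comp _ _ _ (fun x : 'rV[R]_k => x 0 j) (g j)).
  exact: coord_continuous.
exact: cg.
Qed.

Lemma is_derive_tensor (g : 'I_k -> R -> R) i g' (x : 'rV[R]_k) :
  is_derive (x 0 i) 1 (g i) g' ->
  is_derive x (delta_mx 0 i) (tensor g) (g' * \prod_(j | j != i) g j (x 0 j)).
Proof.
set c := \prod_(j | _) _ => dg.
have dcg : is_derive (x 0 i) 1 (c \*: g i) (c * g') by exact: is_deriveZ.
rewrite mulrC.
have E : (fun h => h^-1 *: ((tensor g \o shift x) (h *: delta_mx 0 i) - tensor g x)) =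
   (fun h => h^-1 *: (((c \*: g i) \o shift (x 0 i)) (h *: 1) - (c \*: g i) (x 0 i))).
  apply/funext => h; congr (_ *: _); rewrite /= /tensor (bigD1 i)//= (bigD1 i (P := xpredT))//=.
  rewrite !mxE !eqxx /= /GRing.scale/=.
  rewrite -/c [c * g i (h * 1 + _)]mulrC [g i (x 0 i) * c]mulrC; congr (_ * _ - _).
  by apply: eq_bigr => j ji; rewrite !mxE (negbTE ji) andbF mulr0 add0r.
split.
  by rewrite /derivable E; case: dcg.
by rewrite /derive E; case: dcg.
Qed.

Lemma partial_tensor (g : 'I_k -> R -> R) i g' :
  (forall y : R, is_derive y 1 (g i) (g' y)) ->
  partial i (tensor g) = tensor (fun j => if j == i then g' else g j).
Proof.
move=> dg; apply/funext => x; rewrite /partial.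
have := is_derive_tensor (dg (x 0 i)) => -[_ ->].
rewrite /tensor [RHS](bigD1 i)//= eqxx; congr (_ * _).
by apply: eq_bigr => j /negbTE ->.
Qed.

(** A partial derivative of a product function is a product function, with
    factors in the same class. *)
Lemma smooth_tensor (g : 'I_k -> R -> R) : (forall j, smoothR (g j)) -> smooth (tensor g).
Proof.
move=> sg s.
have [g' sg' ->] : exists2 g', (forall j, smoothR (g' j)) & foldr partial (tensor g) s = tensor g'.
  elim: s => [|i s [g1 sg1 /= ->]]; first by exists g.
  have [g' sg' dg'] := smoothR_derive (sg1 i).
  rewrite (partial_tensor dg').
  exists (fun j => if j == i then g' else g1 j) => // j.
  by case: ifP.
split=> [|i x].
  by apply: continuous_tensor => j; exact: smoothR_continuous.
have [h _ dh] := smoothR_derive (sg' i).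
by have [] := is_derive_tensor (dh (x 0 i)).
Qed.

End tensor.

(** * Translations and boxes for Lebesgue measure on tuples *)

Lemma measurable_preimageT d1 d2 (T1 : measurableType d1) (T2 : measurableType d2)
    (f : T1 -> T2) A :
  measurable_fun setT f -> measurable A -> measurable (f @^-1` A).
Proof. by move=> mf mA; rewrite -[X in measurable X]setTI; exact: mf. Qed.

Section translation.
Context {R : realType}.
Local Notation RT := (measurableTypeR R).
Local Notation leb := (@lebesgue_measure R).

Definition addt k (x z : k.-tuple RT) : k.-tuple RT :=
  [tuple (tnth x j + tnth z j : R) | j < k].

Lemma addtC k (x z : k.-tuple RT) : addt x z = addt z x.
Proof. by apply: eq_from_tnth => j; rewrite !tnth_mktuple addrC. Qed.

Lemma addtA k (x y z : k.-tuple RT) : addt x (addt y z) = addt (addt x y) z.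
Proof. by apply: eq_from_tnth => j; rewrite !tnth_mktuple addrA. Qed.

Lemma measurable_addt d (T : measurableType d) k (f g : T -> k.-tuple RT) :
  measurable_fun setT f -> measurable_fun setT g ->
  measurable_fun setT (fun x => addt (f x) (g x)).
Proof.
move=> mf mg; apply/measurable_fun_tnthP => j.
rewrite (_ : _ \o _ = (fun x => tnth (f x) j : R) \+ (fun x => tnth (g x) j)); last first.
  by apply/funext => x /=; rewrite tnth_mktuple.
apply: measurable_funD.
  exact: (measurableT_comp (measurable_tnth j) mf).
exact: (measurableT_comp (measurable_tnth j) mg).
Qed.

Lemma measurable_shift k (z : k.-tuple RT) : measurable_fun setT (addt z).
Proof. by apply: measurable_addt => //; exact: measurable_id. Qed.

Lemma lebesgue_shift (c : R) (A : set RT) : measurable A ->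
  leb ((fun x : RT => c + x : RT) @^-1` A) = leb A.
Proof.
have mc : measurable_fun setT (fun x : RT => c + x : RT) by exact: measurable_funD.
pose m' := measure_function_pushforward__canonical__measure_function_Measure leb mc.
move=> mA; apply/esym/(@lebesgue_measure_unique _ m') => //= _ [[a b]] _ <-.
rewrite /pushforward (_ : _ @^-1` _ = `]a - c, b - c]%classic).
  rewrite /= !lebesgue_measure_itv/= !lte_fin ltrD2r.
  by rewrite -!EFinD opprB addrA subrK.
by apply/seteqP; split => x /=; rewrite !in_itv/= ltrBlDl lerBrDl.
Qed.

Lemma tcons_addt k (p : RT * k.-tuple RT) (z : k.+1.-tuple RT) :
  addt z (tcons p) = tcons (thead z + p.1 : R, addt [tuple of behead z] p.2).
Proof.
apply: eq_from_tnth => j; rewrite tnth_mktuple.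
have [i ->|->] := unliftP ord0 j.
  by rewrite /tcons !tnthS tnth_mktuple [in LHS](tuple_eta z) tnthS.
by rewrite /tcons !tnth0 [in LHS](tuple_eta z) tnth0.
Qed.

(** By induction on the dimension: the translated measure and the product
    measure agree on rectangles. *)
Lemma tuple_lebesgue_shift k (z : k.-tuple RT) A : measurable A ->
  tuple_lebesgue k (addt z @^-1` A) = tuple_lebesgue k A.
Proof.
elim: k z A => [|k IH] z A mA.
  by congr (tuple_lebesgue 0 _); apply/funext => x; rewrite /preimage/= (tuple0 (addt z x)) (tuple0 x).
rewrite /= /lebesgue_tcons /pushforward.
pose s (p : RT * k.-tuple RT) : RT * k.-tuple RT := (thead z + p.1 : R, addt [tuple of behead z] p.2).
have ms : measurable_fun setT s.
  apply/measurable_fun_pair; first by apply: measurable_funD.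
  exact: (measurableT_comp (measurable_shift _) measurable_snd).
rewrite -comp_preimage (_ : addt z \o _ = @tcons _ k \o s); last first.
  by apply/funext => p /=; rewrite tcons_addt.
rewrite comp_preimage.
pose m' := measure_function_pushforward__canonical__measure_function_Measure
  (leb \x tuple_lebesgue k)%E ms.
have mtA : measurable (@tcons _ k @^-1` A).
  by apply: measurable_preimageT mA; exact: measurable_tcons.
apply/esym/(product_measure_unique (m' := m')) => // B C mB mC.
rewrite /= /pushforward (_ : s @^-1` _ = ((fun x : RT => thead z + x : RT) @^-1` B) `*`
   (addt [tuple of behead z] @^-1` C)); last by [].
rewrite product_measure1E//.
- by rewrite IH//; congr (_ * _)%E; exact: lebesgue_shift.
- by apply: measurable_preimageT => //; exact: measurable_funD.
- by apply: measurable_preimageT => //; exact: measurable_shift.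
Qed.

Definition box k (a b : 'I_k -> R) : set (k.-tuple RT) :=
  [set x | forall j, a j < tnth x j < b j].

Lemma measurable_box k (a b : 'I_k -> R) : measurable (box a b).
Proof.
rewrite (_ : box a b = \big[setI/setT]_(j < k) ((@tnth k RT ^~ j) @^-1` `]a j, b j[)); last first.
  rewrite -bigcap_seq; apply/seteqP; split => [x ax j _|x ax j]/=.
    by rewrite in_itv/= ax.
  by have := ax j (mem_index_enum _); rewrite /= in_itv.
apply: bigsetI_measurable => j _.
by apply: measurable_preimageT => //; exact: measurable_tnth.
Qed.

Lemma tuple_lebesgue_box k (a b : 'I_k -> R) : (forall j, a j <= b j) ->
  tuple_lebesgue k (box a b) = (\prod_j (b j - a j))%:E.
Proof.
elim: k a b => [|k IH] a b ab.
  rewrite big_ord0 /= diracE mem_set//; by case.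
rewrite /= /lebesgue_tcons /pushforward.
rewrite (_ : _ @^-1` _ = `]a ord0, b ord0[%classic `*` box (a \o lift ord0) (b \o lift ord0)); last first.
  apply/seteqP; split => [[x t]/= h|[x t] [/= h1 h2] j].
    split => /=; first by have := h ord0; rewrite in_itv.
    by move=> j; have := h (lift ord0 j); rewrite /tcons tnthS.
  rewrite /tcons; have [i ->|->] := unliftP ord0 j; first by rewrite tnthS; exact: h2.
  by move: h1; rewrite tnth0 in_itv.
rewrite product_measure1E//; last exact: measurable_box.
rewrite IH; last by move=> j; exact: ab.
rewrite /= lebesgue_measure_itv/= big_ord_recl lte_fin.
case: ltP => [_|ba]; first by rewrite -EFinB -EFinM.
have -> : b ord0 = a ord0 by apply/eqP; rewrite eq_le ba ab.
by rewrite subrr !mul0r mul0e.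
Qed.

End translation.

(** * Continuity of translations in the mean *)

Section integral_translation.
Context {R : realType} {k : nat}.
Local Notation RT := (measurableTypeR R).
Local Notation T := (k.-tuple RT).
Local Notation lam := (@tuple_lebesgue R k).
Local Open Scope ereal_scope.

Lemma ge0_integral_shift (z : T) (f : T -> \bar R) :
  measurable_fun setT f -> (forall x, 0 <= f x) ->
  \int[lam]_x f (addt z x) = \int[lam]_x f x.
Proof.
move=> mf f0.
rewrite -[LHS](ge0_integral_pushforward (measurable_shift z) _ measurableT)//.
apply: (eq_measure_integral lam) => [|mz A mA _]; first exact: measurable_shift.
exact: tuple_lebesgue_shift.
Qed.

Lemma integrable_shift (z : T) (f : T -> \bar R) :
  lam.-integrable setT f -> lam.-integrable setT (fun x => f (addt z x)).
Proof.
move=> /integrableP[mf fi]; apply/integrableP; split.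
  exact: (measurableT_comp mf (measurable_shift z)).
rewrite (ge0_integral_shift z (f := fun x => `|f x|))//.
exact: measurableT_comp.
Qed.

Lemma integral_shift (z : T) (f : T -> \bar R) : lam.-integrable setT f ->
  \int[lam]_x f (addt z x) = \int[lam]_x f x.
Proof.
move=> fi; rewrite -[LHS](integral_pushforward (measurable_shift z) _ _ measurableT).
- apply: (eq_measure_integral lam) => [|mz A mA _]; first exact: measurable_shift.
  exact: tuple_lebesgue_shift.
- exact: (measurable_int lam).
- by rewrite preimage_setT; exact: integrable_shift.
Qed.

End integral_translation.

Section L1_continuity.
Import HBSimple.
Context {R : realType} {k : nat}.
Local Notation RT := (measurableTypeR R).
Local Notation T := (k.-tuple RT).
Local Notation lam := (@tuple_lebesgue R k).
Variables (a b : 'I_k -> R) (ab : forall j, a j <= b j).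
Local Notation D := (box a b).

(** The coordinates are nonnegative because the parallelograms below start from
    one of their vertices and follow the axes forwards. *)
Definition small_shift (d : R) : set T := [set z | forall j, 0 <= tnth z j <= d].

Lemma small_shift_le d d' : d <= d' -> small_shift d `<=` small_shift d'.
Proof. by move=> dd' z zd j; have /andP[-> /le_trans] := zd j; apply. Qed.

Definition changed (z : T) (A : set T) : set T :=
  (addt z @^-1` A) `+` A.

(** The sets whose indicator function is translated continuously in the mean
    over [D]. They form a sigma-algebra that contains the coordinate
    half-spaces, so that all Borel sets belong to it. *)
Definition shift_stable (A : set T) := measurable A /\ forall e : R, 0 < e ->
  exists2 d, 0 < d & forall z, small_shift d z -> (lam (D `&` changed z A) <= e%:E)%E.

Lemma measurable_changed z A : measurable A -> measurable (changed z A).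
Proof.
move=> mA; have mzA : measurable (addt z @^-1` A).
  by apply: measurable_preimageT mA; exact: measurable_shift.
by apply: measurableU; exact: measurableD.
Qed.

Lemma shift_stableC A : shift_stable A -> shift_stable (~` A).
Proof.
move=> [mA sA]; split; first exact: measurableC.
move=> e /sA[d d0 h]; exists d => // z /h.
rewrite (_ : changed z (~` A) = changed z A)//.
rewrite /changed; apply/seteqP; split => x /= [[h1 h2]|[h1 h2]]; [right|left|right|left].
all: split => //; exact: contrapT.
Qed.

Lemma lam_box_lty (c d : 'I_k -> R) : (forall j, c j <= d j) -> (lam (box c d) < +oo)%E.
Proof. by move=> cd; rewrite tuple_lebesgue_box// ltry. Qed.

Lemma shift_stableU A B : shift_stable A -> shift_stable B -> shift_stable (A `|` B).
Proof.
move=> [mA sA] [mB sB]; split; first exact: measurableU.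
move=> e e0; have e20 : 0 < e / 2 by rewrite divr_gt0.
have [d1 d10 h1] := sA _ e20; have [d2 d20 h2] := sB _ e20.
exists (Num.min d1 d2); first by rewrite lt_min d10.
move=> z hz.
have /h1 {}h1 : small_shift d1 z by apply: small_shift_le hz; rewrite ge_min lexx.
have /h2 {}h2 : small_shift d2 z by apply: small_shift_le hz; rewrite ge_min lexx orbT.
rewrite [e]splitr EFinD; apply: le_trans (leeD h1 h2).
have mDA : measurable (D `&` changed z A).
  by apply: measurableI; [exact: measurable_box|exact: measurable_changed].
have mDB : measurable (D `&` changed z B).
  by apply: measurableI; [exact: measurable_box|exact: measurable_changed].
apply: le_trans (measureU2 _ mDA mDB).
apply: le_measure; rewrite ?inE.
- apply: measurableI; first exact: measurable_box.
  by apply: measurable_changed; exact: measurableU.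
- exact: measurableU.
- rewrite -setIUr; apply: setIS => x; rewrite /changed /= /setY /=.
  by case=> -[]; tauto.
Qed.

Lemma shift_stable0 : shift_stable set0.
Proof.
split => // e e0; exists 1 => // z _.
by rewrite /changed preimage_set0 /setY setDv setU0 setI0 measure0 lee_fin ltW.
Qed.

Lemma box_small_shift z : small_shift 1 z ->
  D `<=` addt z @^-1` box a (fun j => b j + 1).
Proof.
move=> hz x Dx j; rewrite tnth_mktuple; have := hz j; have := Dx j.
by move=> /andP[h1 h2] /andP[h3 h4]; apply/andP; split; lra.
Qed.

(** A point changes its membership in the union only if it changes its
    membership in a finite union, or if it or its translate is in the remaining
    tail. In a box slightly larger than [D] the tail has small measure. *)
Lemma shift_stable_bigcup (F : (set T)^nat) :
  (forall n, shift_stable (F n)) -> shift_stable (\bigcup_n F n).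
Proof.
move=> sF.
have mF n : measurable (F n) by case: (sF n).
split; first exact: bigcup_measurable.
move=> e e0; have e30 : 0 < e / 3 by rewrite divr_gt0.
pose U := \bigcup_n F n.
pose UN N := \big[setU/set0]_(i < N) F i.
have mUN N : measurable (UN N) by apply: bigsetU_measurable.
have mU : measurable U by exact: bigcup_measurable.
pose D' := box a (fun j => b j + 1).
have mD' : measurable D' by exact: measurable_box.
pose tail N := D' `&` (U `\` UN N).
have mtail N : measurable (tail N) by apply: measurableI => //; exact: measurableD.
have tail0 : \bigcap_N tail N = set0.
  apply/seteqP; split => // x h.
  have [_ [[n _ Fnx] _]] := h 0%N I.
  have [_ [_]] := h n.+1 I; apply.
  by rewrite /UN big_ord_recr/=; right.
have D'lty : (lam D' < +oo)%E.
  by apply: lam_box_lty => j; rewrite (le_trans (ab j))// lerDl.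
have cvtail : (lam \o tail) @ \oo --> 0%E.
  rewrite -(measure0 lam) -tail0; apply: nonincreasing_cvg_mu => //.
  - apply: le_lt_trans D'lty; apply: le_measure; rewrite ?inE//.
    by apply: subIsetl.
  - exact: bigcap_measurable.
  - move=> m n mn; apply/subsetPset; apply: setIS; apply: setDS.
    exact: subset_bigsetU.
have [N hN] : exists N, (lam (tail N) <= (e / 3)%:E)%E.
  have /fine_cvgP[_] := cvtail.
  have /fine_cvgP[fin /cvgrPdist_le/(_ _ e30) [N _ hN]] := cvtail.
  have [M _ hM] := fin.
  exists (maxn M N); have := hN _ (leq_maxr M N) => /=.
  have := hM _ (leq_maxl M N) => /= /fineK {2}<-.
  by rewrite sub0r normrN ger0_norm ?fine_ge0// lee_fin.
have [_ sN] : shift_stable (UN N).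
  rewrite /UN; elim/big_ind : _ => //; [exact: shift_stable0|exact: shift_stableU].
have [d d0 hd] := sN _ e30.
exists (Num.min d 1); first by rewrite lt_min d0/=.
move=> z hz.
have /hd {}hd : small_shift d z by apply: small_shift_le hz; rewrite ge_min lexx.
have z1 : small_shift 1 z by apply: small_shift_le hz; rewrite ge_min lexx orbT.
have mzt : measurable (addt z @^-1` tail N).
  by apply: measurable_preimageT (mtail N); exact: measurable_shift.
have hN' : (lam (addt z @^-1` tail N) <= (e / 3)%:E)%E.
  by rewrite tuple_lebesgue_shift.
have -> : e = e / 3 + e / 3 + e / 3 by field.
rewrite 2!EFinD.
apply: le_trans (leeD (leeD hd hN) hN').
have mDc : measurable (D `&` changed z (UN N)).
  by apply: measurableI; [exact: measurable_box|exact: measurable_changed].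
apply: (@le_trans _ _ (lam (((D `&` changed z (UN N)) `|` tail N) `|` (addt z @^-1` tail N)))).
  apply: le_measure; rewrite ?inE.
  - by apply: measurableI; [exact: measurable_box|exact: measurable_changed].
  - by apply: measurableU => //; exact: measurableU.
  - move=> x [Dx cx].
    have D'x : D' x.
      move=> j; have /andP[-> h] := Dx j; rewrite /= (lt_trans h)// ltrDl; exact: ltr01.
    have D'zx : D' (addt z x) by exact: (box_small_shift z1).
    case: cx => -[/= h1 h2].
    + have [hU|hU] := pselect (UN N (addt z x)); last by right.
      left; left; split => //; left; split => // h; apply: h2.
      by move: h; rewrite /UN -bigcup_mkord => -[i _ ?]; exists i.
    + have [hU|hU] := pselect (UN N x); last by left; right.
      left; left; split => //; right; split => // h; apply: h2.
      by move: h; rewrite /UN -bigcup_mkord => -[i _ ?]; exists i.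
apply: (le_trans (measureU2 _ _ _)) => //; first exact: measurableU.
by rewrite leeD2r//; exact: measureU2.
Qed.

(** The points that enter the half-space lie in a strip whose width is at most
    the size of the shift. *)
Lemma shift_stable_halfspace j (c : R) :
  shift_stable ((@tnth k RT ^~ j) @^-1` `]c, +oo[).
Proof.
set A := _ @^-1` _.
have mA : measurable A.
  by apply: measurable_preimageT => //; exact: measurable_tnth.
split => // e e0.
set P := \prod_(i | i != j) (b i - a i).
have P0 : 0 <= P by apply: prodr_ge0 => i _; rewrite subr_ge0.
exists (e / (2 * (P + 1))); first by rewrite divr_gt0// mulr_gt0// ltr_wpDl.
set d := e / _ => z hz.
have d0 : 0 < d by rewrite divr_gt0// mulr_gt0// ltr_wpDl.
pose a' i := if i == j then c - d else a i.
pose b' i := if i == j then c + d else b i.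
have a'b' i : a' i <= b' i by rewrite /a' /b'; case: ifP => // _; lra.
apply: (@le_trans _ _ (lam (box a' b'))).
  apply: le_measure; rewrite ?inE.
  - by apply: measurableI; [exact: measurable_box|exact: measurable_changed].
  - exact: measurable_box.
  - move=> x [Dx cx] i; rewrite /a' /b'; case: eqVneq => [->|_]; last exact: Dx.
    have /andP[z0 zd] := hz j.
    move: cx; rewrite /changed /setY /A /= !in_itv/= !andbT tnth_mktuple.
    by case=> -[h1 /negP]; rewrite -leNgt => h2; apply/andP; split; lra.
rewrite tuple_lebesgue_box// lee_fin (bigD1 j)//= /a' /b' eqxx.
rewrite (eq_bigr (fun i => b i - a i)); last by move=> i /negbTE ->.
rewrite -/P (_ : c + d - (c - d) = 2 * d); last by ring.
rewrite /d invfM !mulrA mulrAC -mulrA [2 * e * _]mulrAC divff// mul1r.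
have P1 : 0 < P + 1 by rewrite ltr_wpDl.
by rewrite ler_piMr ?(ltW e0)// ler_pdivrMr// mul1r lerDl ler01.
Qed.

Lemma shift_stable_measurable A : measurable A -> shift_stable A.
Proof.
suff : measurable `<=` shift_stable by apply.
apply: smallest_sub.
  split; first exact: shift_stable0.
  - by move=> B sB; rewrite setTD; exact: shift_stableC.
  - exact: shift_stable_bigcup.
rewrite -bigcup_seq; apply: bigcup_sub => j _ _ [B mB <-].
rewrite setTI.
suff sub : <<s @RGenOInfty.G R >> `<=`
    [set B : set RT | shift_stable ((@tnth k RT ^~ j) @^-1` B)].
  apply: sub; have <- : @measurable _ RT = <<s @RGenOInfty.G R >> by exact: RGenOInfty.measurableE.
  exact: mB.
apply: smallest_sub; last by move=> _ [c ->]; exact: shift_stable_halfspace.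
split; first by rewrite /= preimage_set0; exact: shift_stable0.
- by move=> C sC; rewrite setTD /= preimage_setC; exact: shift_stableC.
- by move=> F sF; rewrite /= preimage_bigcup; exact: shift_stable_bigcup.
Qed.

Lemma shift_stable_preimages (g : {sfun T >-> R}) (s : seq R) (e : R) : 0 < e ->
  exists2 d, 0 < d & forall z, small_shift d z ->
    (lam (D `&` \big[setU/set0]_(y <- s) changed z (g @^-1` [set y])) <= e%:E)%E.
Proof.
elim: s e => [|y s IH] e e0.
  by exists 1 => // z _; rewrite big_nil setI0 measure0 lee_fin ltW.
have e20 : 0 < e / 2 by rewrite divr_gt0.
have my y' : measurable (g @^-1` [set y'] : set T).
  by apply: measurable_preimageT => //; exact: measurable_set1.
have [d1 d10 h1] := IH _ e20.
have [_ /(_ _ e20) [d2 d20 h2]] := shift_stable_measurable (my y).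
exists (Num.min d1 d2); first by rewrite lt_min d10.
move=> z hz.
have /h1 {}h1 : small_shift d1 z by apply: small_shift_le hz; rewrite ge_min lexx.
have /h2 {}h2 : small_shift d2 z by apply: small_shift_le hz; rewrite ge_min lexx orbT.
rewrite [e]splitr EFinD big_cons setIUr.
apply: le_trans (leeD h2 h1).
apply: measureU2.
  by apply: measurableI; [exact: measurable_box|exact: measurable_changed].
apply: measurableI; first exact: measurable_box.
by apply: bigsetU_measurable => i _; exact: measurable_changed.
Qed.

(** A simple function is bounded, and its value changes only where the
    membership in one of its finitely many level sets does. *)
Lemma sfun_shift_continuous (g : {sfun T >-> R}) (e : R) : 0 < e ->
  exists2 d, 0 < d & forall z, small_shift d z ->
    (\int[lam]_(x in D) `|g (addt z x) - g x|%:E <= e%:E)%E.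
Proof.
move=> e0.
have /finite_seqP[s gs] : finite_set (range g) by exact: fimfunP.
pose M : R := 1 + 2 * \sum_(y <- s) `|y|.
have sum0 (r : seq R) : 0 <= \sum_(y <- r) `|y| by apply: sumr_ge0.
have M0 : 0 < M by rewrite ltr_pwDl// mulr_ge0.
have gM x : `|g x| <= \sum_(y <- s) `|y|.
  have : g x \in s by have : range g (g x) by []; rewrite gs.
  elim: s {gs M M0} => // y s IH; rewrite big_cons inE => /orP[/eqP->|/IH h].
    by rewrite lerDl.
  by rewrite (le_trans h)// lerDr.
have [d d0 hd] := shift_stable_preimages g s (divr_gt0 e0 M0).
exists d => // z /hd {}hd.
set B := D `&` _ in hd.
have mB : measurable B.
  apply: measurableI; first exact: measurable_box.
  apply: bigsetU_measurable => y _; apply: measurable_changed.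
  by apply: measurable_preimageT => //; exact: measurable_set1.
have mg : measurable_fun setT (fun x => g (addt z x)).
  by apply: measurableT_comp => //; exact: measurable_shift.
have mB1 : measurable_fun setT (fun x : T => (M * \1_B x)%:E).
  by apply: measurableT_comp => //; apply: measurable_funM => //; exact: measurable_indic.
apply: (@le_trans _ _ (\int[lam]_(x in D) (M * \1_B x)%:E)%E).
  apply: ge0_le_integral => //; first exact: measurable_box.
  - apply/measurable_EFinP; apply: measurable_funTS.
    by apply: measurableT_comp => //; apply: measurable_funB.
  - exact: measurable_funTS.
  move=> x Dx; rewrite lee_fin.
  have [->|gx] := eqVneq (g (addt z x)) (g x).
    by rewrite subrr normr0 mulr_ge0// ltW.
  rewrite indicE mem_set ?mulr1.
    apply: (le_trans (ler_normB _ _)); rewrite /M.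
    have := gM x; have := gM (addt z x); lra.
  split => //; rewrite -bigcup_seq; exists (g x) => /=.
    by have : range g (g x) by []; rewrite gs.
  by right; split => // h; move/eqP: gx; apply.
under eq_integral do rewrite EFinM.
rewrite ge0_integralZl//; last 3 first.
- exact: measurable_box.
- by apply/measurable_EFinP; apply: measurable_funTS; exact: measurable_indic.
- by rewrite lee_fin ltW.
rewrite integral_indic//; last exact: measurable_box.
apply: (@le_trans _ _ (M%:E * (e / M)%:E)%E).
  rewrite lee_pmul2l//; apply: le_trans hd.
  apply: le_measure; rewrite ?inE//.
  by apply: measurableI => //; exact: measurable_box.
by rewrite -EFinM lee_fin mulrC divfK// gt_eqF.
Qed.

Theorem L1_shift_continuous (G : T -> R) (e : R) : 0 < e ->
  measurable_fun setT G -> lam.-integrable setT (EFin \o G) ->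
  exists2 d, 0 < d & forall z, small_shift d z ->
    (\int[lam]_(x in D) `|G (addt z x) - G x|%:E <= e%:E)%E.
Proof.
move=> e0 mG iG.
have e30 : 0 < e / 3 by rewrite divr_gt0.
have [g [ig _ g1]] := approximation_sfun_integrable measurableT iG.
have [n hn] : exists n, (\int[lam]_x `|(G x)%:E - (g n x)%:E| <= (e / 3)%:E)%E.
  have /fine_cvgP[fin /cvgrPdist_le/(_ _ e30) [N _ hN]] := g1.
  have [M _ hM] := fin.
  exists (maxn M N); have := hN _ (leq_maxr M N) => /=.
  have := hM _ (leq_maxl M N) => /= /fineK {2}<-.
  by rewrite sub0r normrN ger0_norm ?fine_ge0 ?integral_ge0// lee_fin.
have {}hn : (\int[lam]_x `|G x - g n x|%:E <= (e / 3)%:E)%E.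
  exact: hn.
have [d d0 hd] := sfun_shift_continuous (g n) e30.
exists d => // z /hd {}hd.
have mgz : measurable_fun setT (fun x => g n (addt z x)).
  by apply: measurableT_comp => //; exact: measurable_shift.
have mGz : measurable_fun setT (fun x => G (addt z x)).
  by apply: measurableT_comp => //; exact: measurable_shift.
have mGg : measurable_fun setT (fun x => `|G x - g n x|%:E).
  by apply/measurable_EFinP; apply: measurableT_comp => //; apply: measurable_funB.
have mGgz : measurable_fun setT (fun x => `|G (addt z x) - g n (addt z x)|%:E).
  by apply/measurable_EFinP; apply: measurableT_comp => //; apply: measurable_funB.
have mgg : measurable_fun setT (fun x => `|g n (addt z x) - g n x|%:E).
  by apply/measurable_EFinP; apply: measurableT_comp => //; apply: measurable_funB.
have mD : measurable D by exact: measurable_box.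
have -> : e = e / 3 + e / 3 + e / 3 by field.
rewrite 2!EFinD.
apply: (@le_trans _ _ (\int[lam]_(x in D) (`|G (addt z x) - g n (addt z x)|%:E +
   `|g n (addt z x) - g n x|%:E + `|G x - g n x|%:E))%E).
  apply: ge0_le_integral => //.
  - apply/measurable_EFinP; apply: measurable_funTS; apply: measurableT_comp => //.
    exact: measurable_funB.
  - apply: measurable_funTS; apply: emeasurable_funD => //; exact: emeasurable_funD.
  move=> x _; rewrite -!EFinD lee_fin.
  have -> : G (addt z x) - G x = (G (addt z x) - g n (addt z x)) +
    (g n (addt z x) - g n x) - (G x - g n x) by ring.
  by apply: (le_trans (ler_normB _ _)); rewrite lerD2r ler_normD.
rewrite ge0_integralD//; last 3 first.
- by move=> x _; rewrite -EFinD lee_fin addr_ge0.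
- by apply: measurable_funTS; exact: emeasurable_funD.
- by apply: measurable_funTS.
rewrite ge0_integralD//; last 2 first.
- by apply: measurable_funTS.
- by apply: measurable_funTS.
apply: leeD; [apply: leeD => //|].
- apply: le_trans hn; rewrite -(ge0_integral_shift z (f := fun x => `|G x - g n x|%:E))//.
  by apply: ge0_subset_integral => //.
- by apply: le_trans hn; apply: ge0_subset_integral => //.
Qed.

End L1_continuity.

(** * Bump functions of one variable *)

Section hill.
Context {R : realType}.
Local Notation leb := (@lebesgue_measure R).

Definition hill (eps y : R) : R := flat 0 y * flat 0 (eps - y).

Lemma smoothR_hill eps : smoothR (hill eps).
Proof.
apply: smooth_mul; first exact: smooth_flat.
have := smooth_affine (-1) eps (smooth_flat (R := R) 0).
by congr smoothR; apply/funext => y; rewrite mulN1r addrC.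
Qed.

Lemma flat0_itv (y : R) : 0 <= flat 0 y <= 1.
Proof.
rewrite /flat; case: ifPn => [y0|_]; last by rewrite lexx ler01.
by rewrite expr0 mul1r expR_ge0/= -expR0 ler_expR oppr_le0 invr_ge0 ltW.
Qed.

Lemma flat0_gt0 (y : R) : 0 < y -> 0 < flat 0 y.
Proof. by move=> y0; rewrite /flat y0 expr0 mul1r expR_gt0. Qed.

Lemma hill_itv eps y : 0 <= hill eps y <= 1.
Proof.
have /andP[a0 a1] := flat0_itv y; have /andP[b0 b1] := flat0_itv (eps - y).
by rewrite mulr_ge0//= mulr_ile1.
Qed.

Lemma hill_gt0 eps y : 0 < y < eps -> 0 < hill eps y.
Proof. by move=> /andP[y0 ye]; rewrite mulr_gt0// flat0_gt0// subr_gt0. Qed.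

Lemma hill_support eps y : hill eps y != 0 -> 0 < y < eps.
Proof.
rewrite /hill /flat -[y < eps]subr_gt0; case: (ltP 0 y) => [_|_]; last by rewrite mul0r eqxx.
by case: ltP; rewrite ?mulr0 ?eqxx.
Qed.

Lemma continuous_hill eps : continuous (hill eps).
Proof. exact/smoothR_continuous/smoothR_hill. Qed.

Lemma measurable_hill eps : measurable_fun setT (hill eps).
Proof. by apply: continuous_measurable_fun; exact: continuous_hill. Qed.

Lemma integrable_hill eps (A : set R) : measurable A ->
  leb.-integrable A (EFin \o hill eps).
Proof.
move=> mA.
apply: (@integrableS _ _ _ leb setT) => //.
apply: (@le_integrable _ _ _ _ _ _ _ (fun y => (\1_(`[0, eps]%classic : set (measurableTypeR R)) y)%:E)) => //.
- by apply/measurable_EFinP; exact: measurable_hill.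
- move=> y _; rewrite lee_fin /= indicE.
  have /andP[b0 b1] := hill_itv eps y; rewrite ger0_norm//.
  have [->|/hill_support/andP[y0 ye]] := eqVneq (hill eps y) 0; first exact: normr_ge0.
  by rewrite mem_set ?normr1//= in_itv/= !ltW.
- apply/integrableP; split; first by apply/measurable_EFinP; exact: measurable_indic.
  under eq_integral do rewrite gee0_abs ?lee_fin//.
  rewrite integral_indic// setIT /= lebesgue_measure_itv/=.
  by case: ifP => // _; rewrite -EFinB ltry.
Qed.

Lemma hill_primitive eps : exists P : R -> R, forall x : R, is_derive x 1 P (hill eps x).
Proof.
exists (fun x => (\int[leb]_(t in [set` Interval -oo%O (BRight x)]) hill eps t)%R) => x.
have [] := @continuous_FTC1 R (hill eps) -oo%O x (x + 1) _ _ _ _ => //.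
- by rewrite ltrDl.
- by apply: integrable_hill; exact: measurable_itv.
- by rewrite ltNyr.
- exact: continuous_hill.
- by move=> h1 h2; split => //; rewrite -derive1E.
Qed.

(** Its derivative is the difference of [hill] and a translate of [hill]: as a
    factor of a test function, it turns a weak derivative into an increment. *)
Definition hill_window (eps s w : R) : R :=
  (\int[leb]_(sigma in `[0, s]) hill eps (w - sigma))%R.

Lemma hill_windowE eps s (P : R -> R) : 0 < s ->
  (forall x : R, is_derive x 1 P (hill eps x)) ->
  forall w, hill_window eps s w = P w - P (w - s).
Proof.
move=> s0 dP w.
have dF (x : R) : is_derive x 1 (fun x => - P (w - x)) (hill eps (w - x)).
  have dl : is_derive x 1 (fun x : R => w - x) (-1).
    by have := is_deriveB (is_derive_cst w x 1) (is_derive_id x 1); rewrite sub0r.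
  have := is_deriveN (@is_derive1_comp _ P (fun x => w - x) x _ _ (dP (w - x)) dl).
  by rewrite mulrN1 opprK.
have cont x : {for x, continuous (fun x => hill eps (w - x))}.
  apply: continuous_comp; last exact: continuous_hill.
  by apply: cvgB; [exact: cvg_cst|exact: cvg_id].
rewrite /hill_window /Rintegral (@continuous_FTC2 _ _ (fun x => - P (w - x))) //.
- by rewrite -EFinB /= subr0 opprK addrC.
- by apply: continuous_subspaceT => x; exact: cont.
- have cP x : {for x, continuous (fun x => - P (w - x))}.
    by have [h _] := dF x; apply/differentiable_continuous/derivable1_diffP.
  split.
  + by move=> x _; have [] := dF x.
  + by apply: cvg_at_right_filter; exact: cP.
  + by apply: cvg_at_left_filter; exact: cP.
- by move=> x _; rewrite derive1E; have [_ ->] := dF x.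
Qed.

Lemma is_derive_hill_window eps s (x : R) : 0 < s ->
  is_derive x 1 (hill_window eps s) (hill eps x - hill eps (x - s)).
Proof.
move=> s0; have [P dP] := hill_primitive eps.
have -> : hill_window eps s = P \- (fun w => P (w - s)).
  by apply/funext => w; rewrite (hill_windowE s0 dP).
have dl : is_derive x 1 (fun x : R => x - s) 1.
  by have := is_deriveB (is_derive_id x 1) (is_derive_cst s x 1); rewrite subr0.
have := is_deriveB (dP x) (@is_derive1_comp _ P (fun x => x - s) x _ _ (dP (x - s)) dl).
by rewrite mulr1.
Qed.

Lemma smoothR_hill_window eps s : 0 < s -> smoothR (hill_window eps s).
Proof.
move=> s0; apply: smooth_primitive (fun x => is_derive_hill_window eps x s0).
apply: smooth_add; first exact: smoothR_hill.
have := smooth_mul (smooth_cst (-1)) (smooth_affine 1 (- s) (smoothR_hill eps)).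
by congr smoothR; apply/funext => y /=; rewrite mul1r mulN1r.
Qed.

Lemma hill_window_support eps s w : hill_window eps s w != 0 -> 0 < w < eps + s.
Proof.
apply: contra_neqT => h; rewrite /hill_window.
rewrite (_ : \int[leb]_(_ in _) _ = \int[leb]_(_ in `[0, s]) 0).
  by rewrite Rintegral_cst ?mul0r.
apply: eq_Rintegral => sigma.
rewrite inE/= in_itv/= => /andP[s0 ss].
apply/eqP/negPn/negP => /hill_support/andP[h1 h2]; move/negP: h; apply.
by apply/andP; split; lra.
Qed.

Lemma smoothR_translate (f : R -> R) c : smoothR f -> smoothR (fun y => f (y - c)).
Proof.
move=> /(smooth_affine 1 (- c)); congr smoothR.
by apply/funext => y; rewrite mul1r.
Qed.

Lemma is_derive_translate (f : R -> R) c (y df : R) :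
  is_derive (y - c) 1 f df -> is_derive y 1 (fun y => f (y - c)) df.
Proof.
move=> h.
have dl : is_derive y 1 (fun x : R => x - c) 1.
  by have := is_deriveB (is_derive_id y 1) (is_derive_cst c y 1); rewrite subr0.
by have := @is_derive1_comp _ f (fun x => x - c) y _ _ h dl; rewrite mulr1.
Qed.

End hill.

(** * A function with vanishing averages is zero *)

Section tensor_hill.
Context {R : realType} {k : nat}.
Local Notation RT := (measurableTypeR R).
Local Notation T := (k.-tuple RT).
Local Notation lam := (@tuple_lebesgue R k).

Definition thill (eps : R) (w : T) : R := \prod_j hill eps (tnth w j).

Lemma measurable_prod_fun d (X : measurableType d) (I : Type) (r : seq I) (P : pred I)
    (f : I -> X -> R) :
  (forall i, measurable_fun setT (f i)) ->
  measurable_fun setT (fun x => \prod_(i <- r | P i) f i x).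
Proof.
move=> mf; elim: r => [|i r IH].
  have -> : (fun x => \prod_(i <- [::] | P i) f i x) = cst 1; last exact: measurable_cst.
  by apply/funext => x; rewrite big_nil.
have -> : (fun x => \prod_(j <- i :: r | P j) f j x) =
    if P i then f i \* (fun x => \prod_(j <- r | P j) f j x)
    else (fun x => \prod_(j <- r | P j) f j x).
  by apply/funext => x; rewrite big_cons; case: (P i).
by case: (P i) => //; exact: measurable_funM.
Qed.

Lemma measurable_thill eps : measurable_fun setT (thill eps).
Proof.
apply: measurable_prod_fun => j.
by apply: measurableT_comp; [exact: measurable_hill|exact: measurable_tnth].
Qed.

Lemma thill_itv eps w : 0 <= thill eps w <= 1.
Proof.
rewrite prodr_ge0 => [|j _]; last by have /andP[] := hill_itv eps (tnth w j).
by apply: prodr_ile1 => j _; exact: hill_itv.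
Qed.

Lemma thill_gt0 eps w : box (fun=> 0) (fun=> eps) w -> 0 < thill eps w.
Proof. by move=> h; apply: prodr_gt0 => j _; exact: hill_gt0. Qed.

Lemma thill_support eps w : thill eps w != 0 -> box (fun=> 0) (fun=> eps) w.
Proof. by move=> /prodf_neq0 h j; apply/hill_support/h. Qed.

Lemma integrable_mul_bounded d (X : measurableType d) (mu : {measure set X -> \bar R})
    (M : R) (f g : X -> R) :
  mu.-integrable setT (EFin \o f) -> measurable_fun setT g -> (forall x, `|g x| <= M) ->
  mu.-integrable setT (EFin \o (f \* g)).
Proof.
move=> fi mg gM; have mf : measurable_fun setT f by apply/measurable_EFinP/(measurable_int mu).
have M0 (x : X) : 0 <= M by exact: le_trans (gM x).
apply: (@le_integrable _ _ _ _ _ measurableT _ (fun x => (M * f x)%:E)).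
- by apply/measurable_EFinP; exact: measurable_funM.
- move=> x _; rewrite lee_fin/= !normrM mulrC ler_wpM2r//.
  by rewrite (le_trans (gM x))// ler_norm.
- by have := integrableZl measurableT M fi.
Qed.

Lemma integrable_thill eps : 0 < eps -> lam.-integrable setT (EFin \o thill eps).
Proof.
move=> e0; set B := box (fun=> 0) (fun=> eps) : set T.
have mB : measurable B by exact: measurable_box.
apply: (@le_integrable _ _ _ _ _ measurableT _ (fun y => (\1_B y)%:E)).
- by apply/measurable_EFinP; exact: measurable_thill.
- move=> y _; rewrite lee_fin /= indicE.
  have /andP[b0 b1] := thill_itv eps y; rewrite ger0_norm//.
  have [->|/thill_support h] := eqVneq (thill eps y) 0; first exact: normr_ge0.
  by rewrite mem_set ?normr1.
- apply/integrableP; split; first by apply/measurable_EFinP; exact: measurable_indic.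
  under eq_integral do rewrite gee0_abs ?lee_fin//.
  rewrite integral_indic// setIT; apply: lam_box_lty => _; exact: ltW.
Qed.

Lemma thill_integral_gt0 eps : 0 < eps -> (0 < \int[lam]_x (thill eps x)%:E)%E.
Proof.
move=> e0; set B := box (fun=> 0) (fun=> eps) : set T.
have mB : measurable B by exact: measurable_box.
have tb0 w : 0 <= thill eps w by have /andP[] := thill_itv eps w.
rewrite lt_neqAle integral_ge0 ?andbT => [|w _]; last by rewrite lee_fin.
apply/eqP => h.
have : {ae lam, forall x, setT x -> (EFin \o thill eps) x = 0%E}.
  apply/(ae_eq_integral_abs lam measurableT).
    by apply/measurable_EFinP; exact: measurable_thill.
  by under eq_integral do rewrite /= ger0_norm//.
move=> [N [mN N0 hN]].
have : (lam B <= lam N)%E.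
  apply: le_measure; rewrite ?inE// => x Bx; apply: hN => /= /(_ I) [h0].
  by have := thill_gt0 Bx; rewrite h0 ltxx.
rewrite N0 tuple_lebesgue_box; last by move=> _; exact: ltW.
by rewrite lee_fin leNgt prodr_gt0// => j _; rewrite subr0.
Qed.

End tensor_hill.

Section averaging.
Context {R : realType} {k : nat}.
Local Notation RT := (measurableTypeR R).
Local Notation T := (k.-tuple RT).
Local Notation lam := (@tuple_lebesgue R k).

(** The product of [G x] and the integral of the bump is the average of
    [G x - G (x + w)] against the bump. The integral over [x] of such an average
    is small when the support of the bump is, by continuity of translations. *)
Lemma ae0_of_averages (a b : 'I_k -> R) (G : T -> R) (d0 : R) :
  (forall j, a j <= b j) -> 0 < d0 ->
  measurable_fun setT G -> lam.-integrable setT (EFin \o G) ->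
  (forall eps x, 0 < eps <= d0 -> box a b x ->
     (\int[lam]_w (G (addt x w) * thill eps w)%:E = 0)%E) ->
  {ae lam, forall x, box a b x -> G x = 0}.
Proof.
move=> ab d00 mG iG G0.
pose D := box a b : set T.
have mD : measurable D by exact: measurable_box.
suff D0 : (\int[lam]_(x in D) `|(EFin \o G) x| = 0)%E.
  have : ae_eq lam D (EFin \o G) (cst 0%E).
    apply/(ae_eq_integral_abs lam mD) => //.
    by apply/measurable_EFinP; exact: measurable_funTS.
  by apply: filterS => x h /h [].
apply/eqP; rewrite eq_le integral_ge0 ?andbT; last by move=> x _; exact: abse_ge0.
apply/lee_addgt0Pr => e e0; rewrite add0e.
have [d dgt0 hd] := L1_shift_continuous ab e0 mG iG.
pose eps := Num.min d d0.
have eps0 : 0 < eps by rewrite lt_min dgt0.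
pose phi (w : T) := thill eps w.
have phi0 w : 0 <= phi w by have /andP[] := thill_itv eps w.
have mphi : measurable_fun setT phi by exact: measurable_thill.
pose c := (\int[lam]_w (phi w)%:E)%E.
have c0 : (0 < c)%E by exact: thill_integral_gt0.
have cfin : c \is a fin_num.
  exact: (integrable_fin_num measurableT (integrable_thill eps0)).
rewrite -(@lee_pmul2l _ c)//.
have mGG : measurable_fun [set: T * T] (fun p => `|G (addt p.2 p.1) - G p.1| * phi p.2).
  apply: measurable_funM; last exact: measurableT_comp.
  apply: measurableT_comp => //; apply: measurable_funB; last exact: measurableT_comp.
  apply: measurableT_comp => //; exact: measurable_addt.
apply: (@le_trans _ _ (\int[lam]_(x in D) \int[lam]_w (`|G (addt w x) - G x| * phi w)%:E)%E).
  rewrite -ge0_integralZl//; last 2 first.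
  - by apply: measurable_funTS; apply: measurableT_comp => //; apply/measurable_EFinP.
  - exact: ltW.
  apply: ge0_le_integral => //.
  - by move=> x _; rewrite mule_ge0 ?abse_ge0// ltW.
  - apply: measurable_funTS; apply: emeasurable_funM => //.
    by apply: measurableT_comp => //; apply/measurable_EFinP.
  - apply: measurable_funTS.
    apply: (@measurable_fun_fubini_tonelli_F _ _ _ _ _ lam
      (fun p : T * T => (`|G (addt p.2 p.1) - G p.1| * phi p.2)%:E)).
    + by apply/measurable_EFinP.
    + by move=> p; rewrite lee_fin mulr_ge0.
  move=> x Dx.
  have iGphi : lam.-integrable setT (EFin \o (fun w => G (addt x w) * phi w)).
    apply: (integrable_mul_bounded (M := 1) (f := fun w => G (addt x w)) (g := phi)) => //; first exact: (integrable_shift x iG).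
    by move=> w; rewrite ger0_norm//; have /andP[] := thill_itv eps w.
  have iphi : lam.-integrable setT (EFin \o phi) by exact: integrable_thill.
  have icphi : lam.-integrable setT (EFin \o (fun w => G x * phi w)).
    by have := integrableZl measurableT (G x) iphi.
  have -> : (c * `|(EFin \o G) x| = `|\int[lam]_w (G (addt x w) * phi w - G x * phi w)%:E|)%E.
    rewrite (integralB_EFin measurableT iGphi icphi) G0 ?sub0e ?abseN//; last first.
      by rewrite eps0 /eps ge_min lexx orbT.
    under eq_integral do rewrite EFinM.
    rewrite integralZl// abseM muleC; congr (_ * _)%E.
    by rewrite gee0_abs// ltW.
  apply: (le_trans (le_abse_integral lam measurableT _)).
    apply/measurable_EFinP; apply: measurable_funB; last exact: measurable_funM.
    by apply/measurable_EFinP; exact: (measurable_int lam iGphi).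
  apply: ge0_le_integral => //.
  - apply: measurableT_comp => //; apply/measurable_EFinP; apply: measurable_funB; last exact: measurable_funM.
    by apply/measurable_EFinP; exact: (measurable_int lam iGphi).
  - apply/measurable_EFinP; apply: measurable_funM => //.
    apply: measurableT_comp => //; apply: measurable_funB => //.
    apply: measurableT_comp => //; exact: measurable_addt.
  - by move=> w _; rewrite lee_fin -mulrBl normrM [`|phi w|]ger0_norm// addtC.
pose F (p : T * T) := (`|G (addt p.2 p.1) - G p.1| * phi p.2 * \1_D p.1)%:E.
have F0 p : (0 <= F p)%E by rewrite lee_fin !mulr_ge0.
have mF : measurable_fun setT F.
  apply/measurable_EFinP; apply: measurable_funM => //.
  by apply: measurableT_comp => //; exact: measurable_indic.
have -> : (\int[lam]_(x in D) \int[lam]_w (`|G (addt w x) - G x| * phi w)%:E =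
    \int[lam]_x \int[lam]_w F (x, w))%E.
  rewrite integral_mkcond; apply: eq_integral => x _.
  rewrite patchE /F/= indicE; case: (x \in D).
    by apply: eq_integral => w _; rewrite mulr1.
  by under eq_integral do rewrite mulr0; rewrite integral0.
rewrite (@fubini_tonelli _ _ _ _ _ lam lam F mF F0).
apply: (@le_trans _ _ (\int[lam]_w (e%:E * (phi w)%:E))%E).
  apply: ge0_le_integral => //.
  - by move=> w _; exact: integral_ge0.
  - exact: measurable_fun_fubini_tonelli_G.
  - by apply: emeasurable_funM => //; apply/measurable_EFinP.
  move=> w _; rewrite /F/=.
  have [->|phiw] := eqVneq (phi w) 0.
    by under eq_integral do rewrite mulr0 mul0r; rewrite integral0 mule0.
  have smallw : small_shift d w.
    move=> j; have /andP[/ltW -> /ltW h] := thill_support phiw j.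
    by rewrite (le_trans h)// /eps ge_min lexx.
  rewrite -EFinM mulrC EFinM.
  under eq_integral do rewrite mulrAC EFinM muleC.
  have mw : measurable_fun setT (fun x : T => `|G (addt w x) - G x|).
    apply: measurableT_comp => //; apply: measurable_funB => //.
    by apply: measurableT_comp => //; exact: measurable_shift.
  have m1D : measurable_fun setT (\1_D : T -> R) by exact: measurable_indic.
  have mwD : measurable_fun setT (fun x : T => (`|G (addt w x) - G x| * \1_D x)%:E).
    by apply/measurable_EFinP; exact: measurable_funM.
  rewrite ge0_integralZl//; last by rewrite lee_fin.
  rewrite lee_wpmul2l ?lee_fin//; apply: le_trans (hd w smallw).
  rewrite [X in (_ <= X)%E]integral_mkcond.
  rewrite le_eqVlt; apply/orP; left; apply/eqP; apply: eq_integral => x _.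
  by rewrite patchE indicE; case: ifP => _; rewrite ?mulr1 ?mulr0.
have mphiE : measurable_fun setT (fun w : T => (phi w)%:E) by exact/measurable_EFinP.
rewrite (ge0_integralZl lam measurableT mphiE _ (ltW _)) ?lte_fin//.
  by rewrite [X in (_ <= X)%E]muleC.
by move=> w _; rewrite lee_fin.
Qed.

End averaging.

(** * Integrals along segments parallel to an axis *)

Section axis_shift.
Context {R : realType} {k : nat}.
Local Notation RT := (measurableTypeR R).
Local Notation T := (k.-tuple RT).
Local Notation lam := (@tuple_lebesgue R k).
Local Notation leb := (@lebesgue_measure R).

Definition axis (i : 'I_k) (s : R) : T := [tuple (if j == i then s else 0 : R) | j < k].

Definition oppt (x : T) : T := [tuple (- tnth x j : R) | j < k].

Lemma addtK (z x : T) : addt (oppt z) (addt z x) = x.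
Proof. by apply: eq_from_tnth => j; rewrite !tnth_mktuple addKr. Qed.

Lemma measurable_axis i : measurable_fun setT (axis i : RT -> T).
Proof.
apply/measurable_fun_tnthP => j.
rewrite (_ : _ \o _ = fun s : RT => if j == i then s else 0 : R).
  by case: (j == i); [exact: measurable_id|exact: measurable_cst].
by apply/funext => s /=; rewrite tnth_mktuple.
Qed.

Lemma EFin_Rintegral d (X : measurableType d) (mu : {measure set X -> \bar R})
    (D : set X) (f : X -> R) : measurable D -> mu.-integrable D (EFin \o f) ->
  (\int[mu]_(x in D) f x)%:E = (\int[mu]_(x in D) (f x)%:E)%E.
Proof. by move=> mD fi; rewrite fineK//; exact: (integrable_fin_num mD fi). Qed.

Lemma integrable_measurable d (X : measurableType d) (mu : {measure set X -> \bar R})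
    (f : X -> R) : mu.-integrable setT (EFin \o f) -> measurable_fun setT f.
Proof. by move=> fi; apply/measurable_EFinP; exact: (measurable_int mu fi). Qed.

Lemma measurable_axis_shift i (V : T -> R) (x : T) : measurable_fun setT V ->
  measurable_fun setT (fun p : T * RT => V (addt (axis i p.2) (addt x p.1))).
Proof.
move=> mV; apply: measurableT_comp => //; apply: measurable_addt.
  by apply: measurableT_comp => //; exact: measurable_axis.
by apply: measurableT_comp => //; exact: measurable_shift.
Qed.

Variables (i : 'I_k) (V : T -> R) (s : R).
Hypotheses (iV : lam.-integrable setT (EFin \o V)).

Let mV : measurable_fun setT V. Proof. exact: integrable_measurable iV. Qed.

Definition seg : set RT := `[0, s]%classic.

Lemma measurable_seg : measurable seg. Proof. exact: measurable_itv. Qed.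

Lemma lebesgue_seg_lty : (leb seg < +oo)%E.
Proof. by rewrite lebesgue_measure_itv/=; case: ifP => // _; rewrite -EFinB ltry. Qed.

Lemma integrable_axis_shift (x : T) : (lam \x leb)%E.-integrable setT
  (EFin \o (fun p : T * RT => V (addt (axis i p.2) (addt x p.1)) * \1_seg p.2)).
Proof.
have m1 : measurable_fun setT (fun p : T * RT => \1_seg p.2 : R).
  by apply: measurableT_comp => //; exact: measurable_indic measurable_seg.
set K := fun p : T * RT => V (addt (axis i p.2) (addt x p.1)) * \1_seg p.2.
have mf : measurable_fun setT K.
  by apply: measurable_funM => //; exact: measurable_axis_shift.
apply/integrable21ltyP; first exact/measurable_EFinP.
have -> : (\int[leb]_y \int[lam]_x0 `|(EFin \o K) (x0, y)| =
   \int[leb]_y ((\int[lam]_z `|(V z)%:E|) * (\1_seg y)%:E))%E.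
  apply: eq_integral => y _; rewrite /K/=.
  under eq_integral do rewrite normrM [`|\1_seg y|]ger0_norm// EFinM muleC.
  rewrite ge0_integralZl ?lee_fin//.
    rewrite muleC; congr (_ * _)%E.
    under eq_integral do rewrite addtA.
    rewrite (ge0_integral_shift (addt (axis i y) x) (f := fun z => `|V z|%:E))//.
    by apply/measurable_EFinP; exact: measurableT_comp.
  apply/measurable_EFinP; apply: measurableT_comp => //.
  apply: measurableT_comp => //.
  by apply: measurable_addt => //; exact: measurable_shift.
have /integrableP[_ Vlty] := iV.
rewrite ge0_integralZl//.
- rewrite integral_indic ?setIT//; last exact: measurable_seg.
  by apply: lte_mul_pinfty; rewrite ?ge0_fin_numE ?integral_ge0//; exact: lebesgue_seg_lty.
- by apply/measurable_EFinP; exact: measurable_indic measurable_seg.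
- by apply: integral_ge0.
Qed.

Lemma integrable_mul_window (psi : T * RT -> R) :
  measurable_fun setT psi -> (forall p, `|psi p| <= 1) ->
  (lam \x leb)%E.-integrable setT (EFin \o (fun p : T * RT => V p.1 * psi p * \1_seg p.2)).
Proof.
move=> mpsi psi1.
have m1 : measurable_fun setT (fun p : T * RT => \1_seg p.2 : R).
  by apply: measurableT_comp => //; exact: measurable_indic measurable_seg.
have mV1 : measurable_fun setT (fun p : T * RT => V p.1).
  exact: measurableT_comp.
pose K (p : T * RT) := V p.1 * \1_seg p.2.
apply: (@le_integrable _ _ _ _ _ measurableT _ (EFin \o K)).
- by apply/measurable_EFinP; apply: measurable_funM => //; exact: measurable_funM.
- move=> p _; rewrite lee_fin/= !normrM ler_wpM2r// ler_piMr//.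
apply/integrable12ltyP; first by apply/measurable_EFinP; exact: measurable_funM.
have -> : (\int[lam]_x \int[leb]_y `|(EFin \o K) (x, y)| =
   \int[lam]_x (leb seg * `|(V x)%:E|))%E.
  apply: eq_integral => x _ /=.
  under eq_integral do rewrite normrM [`|\1_seg _|]ger0_norm// EFinM.
  rewrite /= ge0_integralZl ?lee_fin//.
    rewrite muleC; congr (_ * _)%E.
    by rewrite integral_indic ?setIT//; exact: measurable_seg.
  by apply/measurable_EFinP; exact: measurable_indic measurable_seg.
have /integrableP[_ Vlty] := iV.
rewrite ge0_integralZl//.
- apply: lte_mul_pinfty => //; rewrite ge0_fin_numE//; exact: lebesgue_seg_lty.
- by apply: measurableT_comp => //; exact/measurable_EFinP.
Qed.

Definition segment_integral (x : T) : R := \int[leb]_(sigma in seg) V (addt (axis i sigma) x).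

Lemma add0t (y : T) : addt (axis i 0) y = y.
Proof. by apply: eq_from_tnth => j; rewrite !tnth_mktuple if_same add0r. Qed.

Let F (x : T) : \bar R := (\int[leb]_sigma (V (addt (axis i sigma) x) * \1_seg sigma)%:E)%E.

Lemma Rintegral_indic (f : RT -> R) :
  \int[leb]_(sigma in seg) f sigma = \int[leb]_sigma (f sigma * \1_seg sigma).
Proof.
rewrite Rintegral_mkcond; apply: eq_Rintegral => x _.
by rewrite patchE indicE; case: ifP => _; rewrite ?mulr1 ?mulr0.
Qed.

Let segment_integralE x : segment_integral x = fine (F x).
Proof. exact: Rintegral_indic. Qed.

Lemma integrable_indic_seg : leb.-integrable setT (EFin \o (\1_seg : RT -> R)).
Proof.
apply/integrableP; split.
  by apply/measurable_EFinP; exact: measurable_indic measurable_seg.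
under eq_integral do rewrite /= ger0_norm//.
by rewrite integral_indic ?setIT//; [exact: lebesgue_seg_lty|exact: measurable_seg].
Qed.

Let integrable_F : lam.-integrable setT F.
Proof.
have := integrable_fubini_F (integrable_axis_shift (axis i 0)).
congr (_.-integrable setT); apply/funext => x; rewrite /fubini_F /F.
by apply: eq_integral => y _ /=; rewrite add0t.
Qed.

Lemma measurable_segment_integral : measurable_fun setT segment_integral.
Proof.
rewrite (_ : segment_integral = fine \o F); last exact/funext/segment_integralE.
by apply: measurableT_comp => //; exact: (measurable_int lam integrable_F).
Qed.

Lemma integrable_segment_integral : lam.-integrable setT (EFin \o segment_integral).
Proof.
apply: (@le_integrable _ _ _ _ _ measurableT _ F) => //.
- by apply/measurable_EFinP; exact: measurable_segment_integral.
- move=> x _ /=; rewrite segment_integralE; case: (F x) => [r|//|//] /=.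
  + by [].
  + by rewrite normr0 leey.
  + by rewrite normr0 leey.
Qed.

(** Fubini's theorem moves the integral over the segment from the function to
    the test function, after a translation by each point of the segment. *)
Lemma segment_integral_average (x : T) (psi : T -> R) :
  measurable_fun setT psi -> (forall w, `|psi w| <= 1) ->
  (\int[lam]_w (segment_integral (addt x w) * psi w)%:E =
   \int[lam]_y (V y * (\int[leb]_(sigma in seg) psi (addt (oppt (addt (axis i sigma) x)) y))%R)%:E)%E.
Proof.
move=> mpsi psi1.
pose K (p : T * RT) := V (addt (axis i p.2) (addt x p.1)) * \1_seg p.2.
have iK : (lam \x leb)%E.-integrable setT (EFin \o K) by exact: integrable_axis_shift.
pose K1 (p : T * RT) := K p * psi p.1.
have iK1 : (lam \x leb)%E.-integrable setT (EFin \o K1).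
  apply: (integrable_mul_bounded (M := 1) (f := K) (g := psi \o fst)) => //.
    exact: measurableT_comp.
  by move=> p; exact: psi1.
pose psi2 (p : T * RT) := psi (addt (oppt (addt (axis i p.2) x)) p.1).
have mpsi2 : measurable_fun setT psi2.
  apply: measurableT_comp => //; apply: measurable_addt => //.
  apply/measurable_fun_tnthP => j.
  rewrite (_ : _ \o _ = fun p : T * RT => - tnth (addt (axis i p.2) x) j : R); last first.
    by apply/funext => p /=; rewrite tnth_mktuple.
  apply: measurableT_comp => //.
  apply: (measurableT_comp (measurable_tnth j)).
  apply: measurable_addt; last exact: measurable_cst.
  by apply: measurableT_comp => //; exact: measurable_axis.
pose K2 (p : T * RT) := V p.1 * psi2 p * \1_seg p.2.
have iK2 : (lam \x leb)%E.-integrable setT (EFin \o K2) by apply: integrable_mul_window => // p; exact: psi1.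
transitivity (\int[lam]_w \int[leb]_sigma (K1 (w, sigma))%:E)%E.
  apply: ae_eq_integral => //.
  - apply/measurable_EFinP; apply: measurable_funM => //.
    apply: measurableT_comp; first exact: measurable_segment_integral.
    exact: measurable_shift.
  - exact: (measurable_fubini_F iK1).
  have := ae_integrable1 iK.
  apply: filterS => w iKw _.
  have -> : (\int[leb]_sigma (K1 (w, sigma))%:E = F (addt x w) * (psi w)%:E)%E.
    by rewrite -integralZr.
  by rewrite segment_integralE EFinM fineK//; exact: (integrable_fin_num measurableT iKw).
transitivity (\int[leb]_sigma \int[lam]_w (K1 (w, sigma))%:E)%E.
  exact: (Fubini iK1).
transitivity (\int[leb]_sigma \int[lam]_y (K2 (y, sigma))%:E)%E.
  apply: eq_integral => sigma _.
  pose f (y : T) := V y * (psi2 (y, sigma) * \1_seg sigma).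
  have fi : lam.-integrable setT (EFin \o f).
    apply: (integrable_mul_bounded (M := 1)) => //.
    + apply: measurable_funM; last exact: measurable_cst.
      exact: (measurableT_comp mpsi2 (measurable_pair2 _)).
    + move=> y; rewrite normrM mulr_ile1//; first exact: psi1.
      by rewrite indicE; case: (_ \in _); rewrite ?normr1 ?normr0.
  have -> : (\int[lam]_y (K2 (y, sigma))%:E = \int[lam]_y (f y)%:E)%E.
    by apply: eq_integral => y _; rewrite /K2 /f mulrA.
  rewrite -(integral_shift (addt (axis i sigma) x) fi).
  apply: eq_integral => w _; rewrite /f /K1 /K /psi2 /= addtK.
  by rewrite -addtA mulrA mulrAC.
transitivity (\int[lam]_y \int[leb]_sigma (K2 (y, sigma))%:E)%E.
  by rewrite (Fubini iK2).
apply: eq_integral => y _.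
have ipsi : leb.-integrable setT
    (EFin \o (fun sigma => psi (addt (oppt (addt (axis i sigma) x)) y) * \1_seg sigma)).
  have := integrable_mul_bounded (M := 1) (g := fun sigma => psi2 (y, sigma)) integrable_indic_seg.
  under [X in _.-integrable _ (_ \o X)]eq_fun do rewrite mulrC.
  apply; last by move=> sigma; exact: psi1.
  by apply: (measurableT_comp mpsi2); exact: measurable_pair1.
rewrite Rintegral_indic EFinM EFin_Rintegral//.
rewrite -integralZl//.
by apply: eq_integral => sigma _; rewrite /K2 /= mulrAC -mulrA EFinM [X in _ = (_ * X%:E)%E]mulrC.
Qed.

End axis_shift.

(** * Weak derivatives and increments along segments *)

Section weak_difference.
Context {R : realType} {k : nat}.
Local Notation RT := (measurableTypeR R).
Local Notation T := (k.-tuple RT).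
Local Notation lam := (@tuple_lebesgue R k).
Local Notation leb := (@lebesgue_measure R).

(** Product functions already determine the weak derivative, and on tuples they
    can be integrated and differentiated one variable at a time. *)
Definition weak_on_box (A B : 'I_k -> R) (i : 'I_k) (U V : T -> R) :=
  forall (g : 'I_k -> R -> R) (g' : R -> R),
    (forall j, smoothR (g j)) -> (forall y : R, is_derive y 1 (g i) (g' y)) ->
    (forall j y, g j y != 0 -> A j < y < B j) ->
  \int[lam]_x (U x * (g' (tnth x i) * \prod_(j | j != i) g j (tnth x j))) =
  - \int[lam]_x (V x * \prod_j g j (tnth x j)).

Lemma integrableRB d (X : measurableType d) (mu : {measure set X -> \bar R}) D (f g : X -> R) :
  measurable D -> mu.-integrable D (EFin \o f) -> mu.-integrable D (EFin \o g) ->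
  mu.-integrable D (EFin \o (fun x => f x - g x)).
Proof. by move=> mD fi gi; have := integrableB mD fi gi. Qed.

Lemma integrableRD d (X : measurableType d) (mu : {measure set X -> \bar R}) D (f g : X -> R) :
  measurable D -> mu.-integrable D (EFin \o f) -> mu.-integrable D (EFin \o g) ->
  mu.-integrable D (EFin \o (fun x => f x + g x)).
Proof. by move=> mD fi gi; have := integrableD mD fi gi. Qed.

Lemma shift_average (z : T) (U psi : T -> R) :
  lam.-integrable setT (EFin \o U) -> measurable_fun setT psi ->
  (forall w, `|psi w| <= 1) ->
  [/\ lam.-integrable setT (EFin \o (fun w => U (addt z w) * psi w)),
      lam.-integrable setT (EFin \o (fun y => U y * psi (addt (oppt z) y))) &
      \int[lam]_w (U (addt z w) * psi w) = \int[lam]_y (U y * psi (addt (oppt z) y))].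
Proof.
move=> iU mpsi psi1.
have i1 : lam.-integrable setT (EFin \o (fun y => U y * psi (addt (oppt z) y))).
  apply: (integrable_mul_bounded (M := 1) (f := U)) => //.
  by apply: measurableT_comp => //; exact: measurable_shift.
split => //.
  have := integrable_shift z i1; congr (_.-integrable _); apply/funext => w /=.
  by rewrite addtK.
congr fine; rewrite -[RHS](integral_shift z i1); apply: eq_integral => w _ /=.
by rewrite addtK.
Qed.

Lemma thill_axis i (eps sigma : R) (x y : T) :
  thill eps (addt (oppt (addt (axis i sigma) x)) y) =
  hill eps (tnth y i - tnth x i - sigma) *
  \prod_(j | j != i) hill eps (tnth y j - tnth x j).
Proof.
rewrite /thill (bigD1 i)//= !tnth_mktuple eqxx; congr (_ * _).
  by congr hill; ring.
apply: eq_bigr => j ji; rewrite !tnth_mktuple (negbTE ji).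
by congr hill; ring.
Qed.

Lemma integrable_hill_reflect (eps s w : R) :
  leb.-integrable (seg s) (EFin \o (fun sigma => hill eps (w - sigma))).
Proof.
have cont (x : R) : {for x, continuous (fun x => hill eps (w - x))}.
  apply: continuous_comp; last exact: continuous_hill.
  by apply: cvgB; [exact: cvg_cst|exact: cvg_id].
apply: continuous_compact_integrable; first exact: segment_compact.
by apply: continuous_subspaceT => x; exact: cont.
Qed.

Lemma support_inside (A a b B x s d eps y : R) : 0 <= s -> 0 < d -> eps <= d -> A <= a ->
  b + s + d <= B -> a < x < b -> 0 < y - x < eps + s -> A < y < B.
Proof. by move=> s0 d0 ed Aa bB /andP[ax xb] /andP[h1 h2]; apply/andP; split; lra. Qed.

(** The test function with factor [hill_window] in direction [i] and factors
    [hill] in the other directions shows that the averages of the difference of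
    the two sides against small bumps vanish. The gap [d] leaves room for the
    supports of these bumps inside the larger box. *)
Theorem weak_difference (A B a b : 'I_k -> R) i (U V : T -> R) (s d : R) :
  0 < s -> 0 < d -> (forall j, A j <= a j) -> (forall j, a j <= b j) ->
  (forall j, b j + s + d <= B j) ->
  lam.-integrable setT (EFin \o U) -> lam.-integrable setT (EFin \o V) ->
  weak_on_box A B i U V ->
  {ae lam, forall x, box a b x ->
    U (addt (axis i s) x) - U x = segment_integral i V s x}.
Proof.
move=> s0 d0 Aa ab bB iU iV wUV.
pose Us x := U (addt (axis i s) x).
have iUs : lam.-integrable setT (EFin \o Us) by have := integrable_shift (axis i s) iU.
have iW := integrable_segment_integral i s iV.
pose G x := U x - Us x + segment_integral i V s x.
have iUUs : lam.-integrable setT (EFin \o (U \- Us)) by exact: integrableRB.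
have iG : lam.-integrable setT (EFin \o G) by exact: integrableRD.
suff : {ae lam, forall x, box a b x -> G x = 0}.
  apply: filterS => x h /h; rewrite /G /Us => /eqP.
  by rewrite addr_eq0 => /eqP h'; rewrite -[RHS]opprK -h' opprB.
apply: (ae0_of_averages ab d0 _ iG); first exact: integrable_measurable iG.
move=> eps x /andP[eps0 epsd] Dx.
pose phi (w : T) := thill eps w.
have mphi : measurable_fun setT phi by exact: measurable_thill.
have phi1 w : `|phi w| <= 1.
  by have /andP[p0 p1] := thill_itv eps w; rewrite ger0_norm.
have [i1 i1' e1] := shift_average x iU mphi phi1.
have [i2 i2' e2] := shift_average (addt (axis i s) x) iU mphi phi1.
have [i3 _ _] := shift_average x iW mphi phi1.
have e3 := segment_integral_average i s iV x mphi phi1.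
pose c (y : T) := \prod_(j | j != i) hill eps (tnth y j - tnth x j).
pose g (j : 'I_k) (y : R) := if j == i then hill_window eps s (y - tnth x i)
                      else hill eps (y - tnth x j).
pose g' (y : R) := hill eps (y - tnth x i) - hill eps (y - tnth x i - s).
have gc y : \prod_j g j (tnth y j) = hill_window eps s (tnth y i - tnth x i) * c y.
  rewrite (bigD1 i)//= /g eqxx; congr (_ * _).
  by apply: eq_bigr => j /negbTE ->.
have gc' y : \prod_(j | j != i) g j (tnth y j) = c y.
  by apply: eq_bigr => j /negbTE; rewrite /g => ->.
have weak : \int[lam]_y (U y * (g' (tnth y i) * c y)) =
    - \int[lam]_y (V y * (hill_window eps s (tnth y i - tnth x i) * c y)).
  transitivity (\int[lam]_y (U y * (g' (tnth y i) * \prod_(j | j != i) g j (tnth y j)))).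
    by apply: eq_Rintegral => y _; rewrite gc'.
  transitivity (- \int[lam]_y (V y * \prod_j g j (tnth y j))); last first.
    by congr (- _); apply: eq_Rintegral => y _; rewrite gc.
  apply: wUV.
  - move=> j; rewrite /g; case: (j == i).
      exact: (smoothR_translate (tnth x i) (smoothR_hill_window eps s0)).
    exact: (smoothR_translate (tnth x j) (smoothR_hill eps)).
  - move=> y; rewrite /g eqxx.
    exact: (is_derive_translate (is_derive_hill_window eps (y - tnth x i) s0)).
  - move=> j y; rewrite /g.
    have inside := support_inside _ d0 epsd (Aa j) (bB j) (Dx j).
    have [ji|_] := eqVneq j i.
      by subst j; move=> /hill_window_support; apply: inside; exact: ltW.
    move=> /hill_support/andP[h5 h6]; apply: inside; rewrite ?(ltW s0)// h5 (lt_le_trans h6)//.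
    by rewrite lerDl ltW.
have E1 : (\int[lam]_w (G (addt x w) * phi w)%:E =
   (\int[lam]_w (U (addt x w) * phi w) - \int[lam]_w (U (addt (addt (axis i s) x) w) * phi w)
    + \int[lam]_w (segment_integral i V s (addt x w) * phi w))%:E)%E.
  rewrite -RintegralB// -RintegralD//; last exact: integrableRB.
  rewrite EFin_Rintegral//.
    apply: eq_integral => w _; rewrite /G /Us addtA; congr (_%:E); ring.
  by apply: integrableRD => //; exact: integrableRB.
rewrite -[LHS]/(\int[lam]_w (G (addt x w) * phi w)%:E)%E E1 e1 e2.
have -> : \int[lam]_w (segment_integral i V s (addt x w) * phi w) =
    \int[lam]_y (V y * (hill_window eps s (tnth y i - tnth x i) * c y)).
  rewrite /Rintegral e3; congr fine; apply: eq_integral => y _; congr (V y * _)%:E.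
  rewrite /phi; under eq_Rintegral do rewrite thill_axis.
  rewrite RintegralZr//; first exact: measurable_seg.
  exact: integrable_hill_reflect.
rewrite -[X in _ + X]opprK -weak -RintegralB//.
  congr (_%:E); apply/eqP; rewrite subr_eq0; apply/eqP; apply: eq_Rintegral => y _.
  have -> : phi (addt (oppt x) y) = hill eps (tnth y i - tnth x i) * c y.
    by rewrite -[in LHS](add0t i x) /phi thill_axis subr0.
  by rewrite /phi thill_axis /g' -/(c y); ring.
Qed.

End weak_difference.

(** * The area integral along one side *)

Section side.
Context {R : realType}.
Local Notation RT := (measurableTypeR R).
Local Notation leb := (@lebesgue_measure R).

Lemma integrable_ae_le d (X : measurableType d) (mu : {measure set X -> \bar R}) D
    (f g : X -> R) :
  measurable D -> measurable_fun D f -> (forall x, 0 <= g x) ->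
  mu.-integrable D (EFin \o g) -> {ae mu, forall x, D x -> `|f x| <= g x} ->
  mu.-integrable D (EFin \o f) /\ `|\int[mu]_(x in D) f x| <= \int[mu]_(x in D) g x.
Proof.
move=> mD mf g0 gi fg.
have mg : measurable_fun D g by apply/measurable_EFinP; exact: (measurable_int mu gi).
have mnf : measurable_fun D (EFin \o (fun x => `|f x|)).
  by apply/measurable_EFinP; exact: measurableT_comp.
have le1 : (\int[mu]_(x in D) `|(EFin \o f) x| <= \int[mu]_(x in D) (g x)%:E)%E.
  apply: ae_ge0_le_integral => //.
  - by move=> x _; rewrite lee_fin.
  - by apply/measurable_EFinP.
have fi : mu.-integrable D (EFin \o f).
  apply/integrableP; split; first exact/measurable_EFinP.
  apply: le_lt_trans le1 _.
  have /integrableP[_] := gi.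
  by under eq_integral do rewrite /= ger0_norm//.
split => //; apply: le_trans (le_normr_Rintegral mD fi) _.
by rewrite -lee_fin !EFin_Rintegral//; exact: integrable_norm.
Qed.

Lemma integrable_cst_seg (r c : R) : leb.-integrable (seg r) (EFin \o (fun=> c)).
Proof.
apply/integrableP; split; first exact: measurable_cst.
rewrite integral_cst//; last exact: measurable_seg.
by apply: lte_mul_pinfty => //; exact: lebesgue_seg_lty.
Qed.

Lemma seg_sub (s r : R) : s <= r -> seg s `<=` seg r.
Proof. by move=> sr t; rewrite /seg /= !in_itv/= => /andP[-> /le_trans]; apply. Qed.

Lemma Rintegral_seg_cst (s A : R) : 0 <= s -> \int[leb]_(t in seg s) A = s * A.
Proof.
move=> s0; rewrite Rintegral_cst; last exact: measurable_seg.
rewrite /= lebesgue_measure_itv/= lte_fin mulrC.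
case: ltP => [_|s0']; first by rewrite oppr0 adde0.
by have -> : s = 0 by apply/eqP; rewrite eq_le s0 s0'.
Qed.

(** The primitive of [X'] differs from the linear function of slope [A] by at
    most the deviation of [X'] from [A]. *)
Lemma deviation_bound (X' : RT -> R) (r s A : R) : 0 <= s <= r ->
  leb.-integrable (seg r) (EFin \o X') ->
  `|\int[leb]_(t in seg s) X' t - s * A| <= \int[leb]_(t in seg r) `|X' t - A|.
Proof.
move=> /andP[s0 sr] iX.
have ms := measurable_seg s; have mr := measurable_seg r.
have iXs : leb.-integrable (seg s) (EFin \o X').
  by apply: (integrableS mr ms _ iX); exact: seg_sub.
rewrite -Rintegral_seg_cst// -RintegralB//; last exact: integrable_cst_seg.
have iXA : leb.-integrable (seg s) (EFin \o (fun t => X' t - A)).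
  by apply: integrableRB => //; exact: integrable_cst_seg.
apply: (le_trans (le_normr_Rintegral ms iXA)).
have iXAr : leb.-integrable (seg r) (EFin \o (fun t => `|X' t - A|)).
  by apply: integrable_norm; apply: integrableRB => //; exact: integrable_cst_seg.
rewrite -lee_fin !EFin_Rintegral//; last exact: integrable_norm.
apply: ge0_subset_integral => //.
  exact: (measurable_int leb iXAr).
exact: seg_sub.
Qed.

Lemma area_expand (a b s x y u v : R) :
  (s * a + u) * (b + y) - (s * b + v) * (a + x) =
  s * a * y + u * b + u * y - (s * b * x + v * a + v * x).
Proof. by ring. Qed.

Lemma area_bound (a b s r x y u v ex ey : R) : 0 <= s <= r ->
  `|u| <= ex -> `|v| <= ey ->
  `|(s * a + u) * (b + y) - (s * b + v) * (a + x)| <=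
  (r * `|a| + ex) * `|y| + (r * `|b| + ey) * `|x| + (ex * `|b| + ey * `|a|).
Proof.
move=> /andP[s0 sr] uex vey; rewrite area_expand.
apply: (@le_trans _ _ (s * `|a| * `|y| + `|u| * `|b| + `|u| * `|y|
   + (s * `|b| * `|x| + `|v| * `|a| + `|v| * `|x|))).
  apply: (le_trans (ler_normB _ _)); apply: lerD.
    apply: (le_trans (ler_normD _ _)); apply: lerD; last by rewrite normrM.
    by apply: (le_trans (ler_normD _ _)); rewrite !normrM (ger0_norm s0).
  apply: (le_trans (ler_normD _ _)); apply: lerD; last by rewrite normrM.
  by apply: (le_trans (ler_normD _ _)); rewrite !normrM (ger0_norm s0).
have h1 : s * `|a| * `|y| <= r * `|a| * `|y| by rewrite !ler_wpM2r.
have h2 : s * `|b| * `|x| <= r * `|b| * `|x| by rewrite !ler_wpM2r.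
have h3 : `|u| * `|b| <= ex * `|b| by rewrite ler_wpM2r.
have h4 : `|v| * `|a| <= ey * `|a| by rewrite ler_wpM2r.
have h5 : `|u| * `|y| <= ex * `|y| by rewrite ler_wpM2r.
have h6 : `|v| * `|x| <= ey * `|x| by rewrite ler_wpM2r.
rewrite !mulrDl; lra.
Qed.

Lemma bounded_primitive (X X' : RT -> R) (X0 A r : R) :
  leb.-integrable (seg r) (EFin \o X') ->
  {ae leb, forall s, seg r s -> X s - X0 = \int[leb]_(t in seg s) X' t} ->
  {ae leb, forall s, seg r s ->
    `|X s - X0 - s * A| <= \int[leb]_(t in seg r) `|X' t - A|}.
Proof.
move=> iX; apply: filterS => s h sr; rewrite h//.
by apply: deviation_bound => //; move: sr; rewrite /seg/= in_itv.
Qed.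

(** The area swept by the curve [(X, Y)], seen from its starting point, is the
    integral of [(X - X0) Y' - (Y - Y0) X']. With [X - X0 = s A + u] and
    [X' = A + x], and similarly for [Y], the terms free of [u], [v], [x] and [y]
    cancel ([area_expand]); what remains is controlled by the deviations. The
    identities between [X] and [X'] hold for almost every parameter, as they do
    for a Sobolev function on almost every segment. *)
Lemma side_area (X Y X' Y' : RT -> R) (X0 Y0 A B r : R) : 0 <= r ->
  measurable_fun setT X -> measurable_fun setT Y ->
  leb.-integrable (seg r) (EFin \o X') -> leb.-integrable (seg r) (EFin \o Y') ->
  {ae leb, forall s, seg r s -> X s - X0 = \int[leb]_(t in seg s) X' t} ->
  {ae leb, forall s, seg r s -> Y s - Y0 = \int[leb]_(t in seg s) Y' t} ->
  let eX := \int[leb]_(t in seg r) `|X' t - A| in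
  let eY := \int[leb]_(t in seg r) `|Y' t - B| in
  leb.-integrable (seg r) (EFin \o (fun s => X s * Y' s - Y s * X' s)) /\
  `|\int[leb]_(s in seg r) (X s * Y' s - Y s * X' s) -
    (X0 * \int[leb]_(s in seg r) Y' s - Y0 * \int[leb]_(s in seg r) X' s)| <=
   2 * (r * `|A| * eY + r * `|B| * eX + eX * eY).
Proof.
move=> r0 mX mY iX iY hX hY eX eY.
have mr := measurable_seg r.
have mX' : measurable_fun (seg r) X' by apply/measurable_EFinP; exact: (measurable_int leb iX).
have mY' : measurable_fun (seg r) Y' by apply/measurable_EFinP; exact: (measurable_int leb iY).
have icst c : leb.-integrable (seg r) (EFin \o (fun=> c)) := integrable_cst_seg r c.
have iXA : leb.-integrable (seg r) (EFin \o (fun t => `|X' t - A|)).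
  by apply: integrable_norm; exact: integrableRB.
have iYB : leb.-integrable (seg r) (EFin \o (fun t => `|Y' t - B|)).
  by apply: integrable_norm; exact: integrableRB.
have eX0 : 0 <= eX by apply: Rintegral_ge0.
have eY0 : 0 <= eY by apply: Rintegral_ge0.
have iZ c (f : RT -> R) : leb.-integrable (seg r) (EFin \o f) ->
    leb.-integrable (seg r) (EFin \o (fun s => c * f s)).
  by move=> fi; have := integrableZl mr c fi.
pose h s := (X s - X0) * Y' s - (Y s - Y0) * X' s.
pose g s := (r * `|A| + eX) * `|Y' s - B| + (r * `|B| + eY) * `|X' s - A|
   + (eX * `|B| + eY * `|A|).
have g0 s : 0 <= g s by rewrite !addr_ge0// !mulr_ge0// addr_ge0// mulr_ge0.
have ig1 : leb.-integrable (seg r)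
    (EFin \o (fun s => (r * `|A| + eX) * `|Y' s - B| + (r * `|B| + eY) * `|X' s - A|)).
  by apply: integrableRD => //; exact: iZ.
have ig : leb.-integrable (seg r) (EFin \o g) by exact: integrableRD.
have mh : measurable_fun (seg r) h.
  apply: measurable_funB; apply: measurable_funM => //; apply: measurable_funTS.
    exact: measurable_funB.
  exact: measurable_funB.
have [ih hle] : leb.-integrable (seg r) (EFin \o h) /\
    `|\int[leb]_(s in seg r) h s| <= \int[leb]_(s in seg r) g s.
  apply: integrable_ae_le => //.
  have := bounded_primitive A iX hX; have := bounded_primitive B iY hY.
  apply: filterS2 => s hYs hXs rs.
  rewrite /h /g.
  have s0r : 0 <= s <= r by move: rs; rewrite /seg/= in_itv.
  have := area_bound A B (X' s - A) (Y' s - B) s0r (hXs rs) (hYs rs).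
  by rewrite !subrKC.
have i0 : leb.-integrable (seg r) (EFin \o (fun s => X0 * Y' s - Y0 * X' s)).
  by apply: integrableRB => //; exact: iZ.
have E s : X s * Y' s - Y s * X' s = h s + (X0 * Y' s - Y0 * X' s) by rewrite /h; ring.
split.
  rewrite (_ : (fun s => _) = (fun s => h s + (X0 * Y' s - Y0 * X' s))); last exact/funext/E.
  exact: integrableRD.
rewrite (eq_Rintegral _ _ (g := fun s => h s + (X0 * Y' s - Y0 * X' s))); last by move=> s _; exact: E.
have iz1 := iZ X0 _ iY; have iz2 := iZ Y0 _ iX.
rewrite (RintegralD mr ih i0) (RintegralB mr iz1 iz2).
rewrite !RintegralZl// addrK.
apply: (le_trans hle).
have iz3 := iZ (r * `|A| + eX) _ iYB; have iz4 := iZ (r * `|B| + eY) _ iXA.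
rewrite /g (RintegralD mr ig1 (icst _)) (RintegralD mr iz3 iz4).
rewrite !RintegralZl// Rintegral_seg_cst// -/eX -/eY.
by rewrite le_eqVlt; apply/orP; left; apply/eqP; ring.
Qed.
End side.

(** * The contact equation around a parallelogram *)

Section Rintegral_sum.
Context {R : realType}.

Lemma Rintegral_sum d (X : measurableType d) (mu : {measure set X -> \bar R}) D
    (I : Type) (s : seq I) (f : I -> X -> R) :
  measurable D -> (forall i, mu.-integrable D (EFin \o f i)) ->
  mu.-integrable D (EFin \o (fun x => \sum_(i <- s) f i x)) /\
  \int[mu]_(x in D) (\sum_(i <- s) f i x) = \sum_(i <- s) \int[mu]_(x in D) f i x.
Proof.
move=> mD fi; elim: s => [|i s [IH1 IH2]].
  have E : (fun x => \sum_(i <- [::]) f i x) = fun=> 0.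
    by apply/funext => x; rewrite big_nil.
  rewrite E big_nil /Rintegral integral0; split => //.
  exact: integrable0.
have E : (fun x => \sum_(j <- i :: s) f j x) = fun x => f i x + \sum_(j <- s) f j x.
  by apply/funext => x; rewrite big_cons.
rewrite E big_cons -IH2; split; first exact: integrableRD.
by rewrite RintegralD.
Qed.

End Rintegral_sum.

Section loop.
Context {R : realType} {k n : nat}.
Local Notation RT := (measurableTypeR R).
Local Notation T := (k.-tuple RT).
Local Notation leb := (@lebesgue_measure R).
Local Notation comp := ('I_(2 * n).+1).
Variables (U : comp -> T -> R) (V : 'I_k -> comp -> T -> R).
Hypothesis mU : forall c, measurable_fun setT (U c).

Definition contact_at (i : 'I_k) (x : T) := V i it x +
  2 * \sum_(j < n) (U (ix j) x * V i (iy j) x - U (iy j) x * V i (ix j) x) = 0.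

(** These properties hold for almost every starting point [y]. The endpoint is
    treated apart from the intermediate points: the increments around the
    parallelogram are values at vertices, which an identity for almost every
    parameter does not reach. *)
Definition good_side (i : 'I_k) (r : R) (y : T) : Prop :=
  [/\ forall c, U c (addt (axis i r) y) - U c y = segment_integral i (V i c) r y,
      forall c, {ae leb, forall s, seg r s ->
        U c (addt (axis i s) y) - U c y = segment_integral i (V i c) s y},
      forall c, leb.-integrable (seg r) (EFin \o (fun s => V i c (addt (axis i s) y))) &
      {ae leb, forall s, seg r s -> contact_at i (addt (axis i s) y)}].

(** The contact equation expresses the increment of the last component as an
    integral to which [side_area] applies. *)
Lemma side_estimate (i : 'I_k) (r kappa M : R) (y : T) (A : comp -> R) :
  0 <= r -> good_side i r y -> (forall c, `|A c| <= M) ->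
  (forall c, \int[leb]_(s in seg r) `|V i c (addt (axis i s) y) - A c| <= kappa) ->
  `|(U it (addt (axis i r) y) - U it y) + 2 * \sum_(j < n)
      (U (ix j) y * (U (iy j) (addt (axis i r) y) - U (iy j) y)
       - U (iy j) y * (U (ix j) (addt (axis i r) y) - U (ix j) y))| <=
    n%:R * (4 * (2 * (r * M * kappa) + kappa ^+ 2)).
Proof.
move=> r0 [ends prim iV ctc] AM ek.
have mr := measurable_seg r.
have mUs c : measurable_fun setT (fun s : RT => U c (addt (axis i s) y)).
  apply: measurableT_comp => //; apply: measurable_addt; last exact: measurable_cst.
  exact: measurable_axis.
pose area (j : 'I_n) s := U (ix j) (addt (axis i s) y) * V i (iy j) (addt (axis i s) y) -
   U (iy j) (addt (axis i s) y) * V i (ix j) (addt (axis i s) y).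
have sa (j : 'I_n) := side_area (A (ix j)) (A (iy j)) r0 (mUs (ix j)) (mUs (iy j))
  (iV (ix j)) (iV (iy j)) (prim (ix j)) (prim (iy j)).
have iarea j : leb.-integrable (seg r) (EFin \o area j) by have [] := sa j.
have [iS eS] := Rintegral_sum (index_enum 'I_n) mr iarea.
have ivert : leb.-integrable (seg r) (EFin \o (fun s => V i it (addt (axis i s) y) +
    2 * \sum_(j < n) area j s)).
  by apply: integrableRD => //; have := integrableZl mr 2 iS.
have vert : U it (addt (axis i r) y) - U it y = - (2 * \sum_(j < n) \int[leb]_(s in seg r) area j s).
  have [_] : leb.-integrable (seg r) (EFin \o (fun s => V i it (addt (axis i s) y) +
        2 * \sum_(j < n) area j s)) /\
      `|\int[leb]_(s in seg r) (V i it (addt (axis i s) y) + 2 * \sum_(j < n) area j s)| <=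
      \int[leb]_(s in seg r) 0.
    apply: integrable_ae_le => //.
    - by apply/measurable_EFinP; exact: (measurable_int leb ivert).
    - exact: integrable0.
    - by apply: filterS ctc => s h /h ->; rewrite normr0.
  rewrite Rintegral_seg_cst// mulr0 normr_le0 RintegralD//; last first.
    by have := integrableZl mr 2 iS.
  rewrite RintegralZl// eS addr_eq0 => /eqP <-.
  by rewrite ends.
have kappa0 : 0 <= kappa by apply: le_trans (ek it); exact: Rintegral_ge0.
have M0 : 0 <= M by exact: le_trans (AM it).
rewrite vert addrC -mulrN -mulrDr -sumrN -big_split/= normrM ger0_norm//.
apply: (@le_trans _ _ (2 * \sum_(j < n) (2 * (2 * (r * M * kappa) + kappa ^+ 2)))); last first.
  rewrite sumr_const card_ord -mulr_natl le_eqVlt; apply/orP; left; apply/eqP; ring.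
rewrite ler_wpM2l//; apply: (le_trans (ler_norm_sum _ _ _)); apply: ler_sum => j _.
have [_ h] := sa j; rewrite -normrN opprD opprK addrC !ends.
apply: (le_trans h); rewrite ler_wpM2l//.
apply: (@le_trans _ _ (r * M * kappa + r * M * kappa + kappa * kappa)); last first.
  by rewrite le_eqVlt; apply/orP; left; apply/eqP; ring.
apply: lerD; first apply: lerD.
- by apply: ler_pM; rewrite ?ek ?mulr_ge0 ?Rintegral_ge0// ler_wpM2l.
- by apply: ler_pM; rewrite ?ek ?mulr_ge0 ?Rintegral_ge0// ler_wpM2l.
- by apply: ler_pM; rewrite ?ek ?Rintegral_ge0.
Qed.

Lemma side_increment (i : 'I_k) (r kappa : R) (y : T) (a : R) c :
  0 <= r -> good_side i r y ->
  \int[leb]_(s in seg r) `|V i c (addt (axis i s) y) - a| <= kappa ->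
  `|U c (addt (axis i r) y) - U c y - r * a| <= kappa.
Proof.
move=> r0 [ends _ iV _]; apply: le_trans; rewrite ends.
by apply: deviation_bound => //; rewrite r0 lexx.
Qed.

Lemma product_bound (p q a b r kappa M : R) : 0 <= r ->
  `|a| <= M -> `|b| <= M -> `|p - r * a| <= kappa -> `|q - r * b| <= kappa ->
  `|p * q - r ^+ 2 * (a * b)| <= 2 * (r * M * kappa) + kappa ^+ 2.
Proof.
move=> r0 aM bM pk qk.
have -> : p * q - r ^+ 2 * (a * b) =
  (p - r * a) * (q - r * b) + (p - r * a) * (r * b) + r * a * (q - r * b) by ring.
have k0 : 0 <= kappa by exact: le_trans pk.
have M0 : 0 <= M by exact: le_trans aM.
apply: (le_trans (ler_normD _ _)).
apply: (@le_trans _ _ (kappa * kappa + kappa * (r * M) + r * M * kappa)); last first.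
  by rewrite le_eqVlt; apply/orP; left; apply/eqP; ring.
apply: lerD; last first.
  rewrite !normrM (ger0_norm r0); apply: ler_pM; rewrite ?mulr_ge0//.
  by rewrite ler_wpM2l.
apply: (le_trans (ler_normD _ _)); rewrite !normrM (ger0_norm r0); apply: lerD.
  exact: ler_pM.
by apply: ler_pM; rewrite ?mulr_ge0// ler_wpM2l.
Qed.

(** The standard symplectic form, evaluated on the horizontal parts. *)
Definition area_form (A B : comp -> R) : R :=
  \sum_(l < n) (A (ix l) * B (iy l) - A (iy l) * B (ix l)).

Lemma area_form_estimate (P Q A B : comp -> R) (r kappa M : R) : 0 <= r ->
  (forall c, `|A c| <= M) -> (forall c, `|B c| <= M) ->
  (forall c, `|P c - r * A c| <= kappa) -> (forall c, `|Q c - r * B c| <= kappa) ->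
  `|area_form P Q - r ^+ 2 * area_form A B| <=
    n%:R * (2 * (2 * (r * M * kappa) + kappa ^+ 2)).
Proof.
move=> r0 AM BM PA QB.
rewrite /area_form mulr_sumr -sumrB; apply: (le_trans (ler_norm_sum _ _ _)).
apply: (@le_trans _ _ (\sum_(j < n) (2 * (2 * (r * M * kappa) + kappa ^+ 2)))); last first.
  by rewrite sumr_const card_ord [leRHS]mulr_natl.
apply: ler_sum => l _.
have h1 := product_bound r0 (AM (ix l)) (BM (iy l)) (PA (ix l)) (QB (iy l)).
have h2 := product_bound r0 (AM (iy l)) (BM (ix l)) (PA (iy l)) (QB (ix l)).
rewrite [leRHS](_ : _ = (2 * (r * M * kappa) + kappa ^+ 2) + (2 * (r * M * kappa) + kappa ^+ 2)).
  apply: le_trans (lerD h1 h2).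
  rewrite [X in `|X| <= _](_ : _ = (P (ix l) * Q (iy l) - r ^+ 2 * (A (ix l) * B (iy l)))
    - (P (iy l) * Q (ix l) - r ^+ 2 * (A (iy l) * B (ix l)))); first exact: ler_normB.
  by ring.
by ring.
Qed.

(** The opposite sides of the parallelogram are both run forwards, from [x] or
    from a vertex next to it. All deviations are measured from the derivatives
    at the same point [x]. *)
Definition good_loop (i j : 'I_k) (r kappa : R) (x : T) : Prop :=
  [/\ good_side i r x /\ (forall c,
        \int[leb]_(s in seg r) `|V i c (addt (axis i s) x) - V i c x| <= kappa),
      good_side j r (addt (axis i r) x) /\ (forall c,
        \int[leb]_(s in seg r) `|V j c (addt (axis j s) (addt (axis i r) x)) - V j c x| <= kappa),
      good_side i r (addt (axis j r) x) /\ (forall c,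
        \int[leb]_(s in seg r) `|V i c (addt (axis i s) (addt (axis j r) x)) - V i c x| <= kappa) &
      good_side j r x /\ (forall c,
        \int[leb]_(s in seg r) `|V j c (addt (axis j s) x) - V j c x| <= kappa)].

Lemma loop_cancellation (t0 t1 t2 t3 a1 a2 a3 a4 w e : R) :
  a1 + a2 - a3 - a4 = w ->
  `|t1 - t0 + 2 * a1| <= e -> `|t2 - t1 + 2 * a2| <= e ->
  `|t2 - t3 + 2 * a3| <= e -> `|t3 - t0 + 2 * a4| <= e ->
  `|w| <= 2 * e.
Proof.
move=> <-; rewrite !ler_norml => /andP[h1 h2] /andP[h3 h4] /andP[h5 h6] /andP[h7 h8].
by apply/andP; split; lra.
Qed.

Lemma two_forms_bound (w1 w2 a r2 e1 e2 : R) :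
  `|w1 - r2 * a| <= e1 -> `|w2 - r2 * a| <= e1 -> `|w1 + w2| <= e2 -> 0 <= r2 ->
  r2 * `|a| <= e1 + e2 / 2.
Proof.
move=> + + + r0; have -> : r2 * `|a| = `|r2 * a| by rewrite normrM ger0_norm.
rewrite !ler_norml.
move=> /andP[h1 h2] /andP[h3 h4] /andP[h5 h6].
by apply/andP; split; lra.
Qed.

(** The increments of the last component along the two paths from [x] to the
    opposite vertex are equal. The horizontal contributions that remain are the
    area forms of two pairs of consecutive sides, each of which is close to
    [r ^+ 2] times the area form of the derivatives at [x]. *)
Lemma loop_estimate (i j : 'I_k) (r kappa M : R) (x : T) : 0 <= r ->
  good_loop i j r kappa x ->
  (forall c, `|V i c x| <= M) -> (forall c, `|V j c x| <= M) ->
  r ^+ 2 * `|area_form (V i ^~ x) (V j ^~ x)| <=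
    n%:R * (6 * (2 * (r * M * kappa) + kappa ^+ 2)).
Proof.
move=> r0 [[g1 k1] [g2 k2] [g3 k3] [g4 k4]] iM jM.
pose x1 := addt (axis i r) x; pose x3 := addt (axis j r) x.
pose x2 := addt (axis j r) x1.
have x2E : addt (axis i r) x3 = x2 by rewrite /x2 /x1 /x3 !addtA (addtC (axis i r)).
have s1 := side_estimate r0 g1 iM k1.
have s2 := side_estimate r0 g2 jM k2.
have s3 := side_estimate r0 g3 iM k3.
have s4 := side_estimate r0 g4 jM k4.
have d1 c := side_increment r0 g1 (k1 c).
have d2 c := side_increment r0 g2 (k2 c).
have d3 c := side_increment r0 g3 (k3 c).
have d4 c := side_increment r0 g4 (k4 c).
rewrite -/x1 -/x3 -/x2 ?x2E in s1 s2 s3 s4 d1 d2 d3 d4.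
have f1 := area_form_estimate r0 iM jM d1 d2.
have f2 := area_form_estimate r0 iM jM d3 d4.
have E : \sum_(l < n) (U (ix l) x * (U (iy l) x1 - U (iy l) x) - U (iy l) x * (U (ix l) x1 - U (ix l) x))
  + \sum_(l < n) (U (ix l) x1 * (U (iy l) x2 - U (iy l) x1) - U (iy l) x1 * (U (ix l) x2 - U (ix l) x1))
  - \sum_(l < n) (U (ix l) x3 * (U (iy l) x2 - U (iy l) x3) - U (iy l) x3 * (U (ix l) x2 - U (ix l) x3))
  - \sum_(l < n) (U (ix l) x * (U (iy l) x3 - U (iy l) x) - U (iy l) x * (U (ix l) x3 - U (ix l) x))
  = area_form (fun c => U c x1 - U c x) (fun c => U c x2 - U c x1) +
    area_form (fun c => U c x2 - U c x3) (fun c => U c x3 - U c x).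
  rewrite /area_form -!big_split/= -!sumrB/=.
  by apply: eq_bigr => l _; ring.
have w := loop_cancellation E s1 s2 s3 s4.
have := two_forms_bound f1 f2 w (exprn_ge0 2 r0).
move=> h; apply: (le_trans h).
by rewrite le_eqVlt; apply/orP; left; apply/eqP; field.
Qed.

End loop.

(** * Null sets, oscillations and joint measurability *)

Section ae_tools.
Context {R : realType} {k : nat}.
Local Notation RT := (measurableTypeR R).
Local Notation T := (k.-tuple RT).
Local Notation lam := (@tuple_lebesgue R k).
Local Notation leb := (@lebesgue_measure R).

Lemma ae_shift (z : T) (P : T -> Prop) :
  {ae lam, forall x, P x} -> {ae lam, forall x, P (addt z x)}.
Proof.
move=> [N [mN N0 PN]]; exists (addt z @^-1` N); split.
- by apply: measurable_preimageT mN; exact: measurable_shift.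
- by rewrite tuple_lebesgue_shift.
- by move=> x Px; apply: PN.
Qed.

(** Fubini's theorem for null sets: the measure of [E] can be computed from
    either family of sections. *)
Lemma ae_exchange (E : set (T * RT)) : measurable E ->
  (forall s, lam (ysection E s) = 0%E) ->
  {ae lam, forall y, {ae leb, forall s, ~ E (y, s)}}.
Proof.
move=> mE E0.
have int0 : (\int[lam]_y leb (xsection E y) = 0)%E.
  have := indic_fubini_tonelli lam leb mE.
  rewrite indic_fubini_tonelli_FE// indic_fubini_tonelli_GE//= => ->.
  under eq_integral do rewrite E0.
  exact: integral0.
have mx : measurable_fun setT (fun y => leb (xsection E y)) by exact: measurable_fun_xsection.
have : ae_eq lam setT (fun y => leb (xsection E y)) (cst 0%E).
  apply/(ae_eq_integral_abs lam measurableT mx).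
  by under eq_integral do rewrite gee0_abs//.
apply: filterS => y /(_ I) y0; exists (xsection E y); split => //.
- exact: measurable_xsection.
- by move=> s /= /contrapT ?; rewrite /xsection/= inE.
Qed.

Lemma measurable_ler_set d (X : measurableType d) (f g : X -> R) :
  measurable_fun setT f -> measurable_fun setT g -> measurable [set x | f x <= g x].
Proof.
move=> mf mg; rewrite (_ : [set x | _] = (g \- f) @^-1` `[0, +oo[).
  by apply: measurable_preimageT => //; exact: measurable_funB.
by apply/seteqP; split => x /=; rewrite in_itv/= andbT subr_ge0.
Qed.

(** Joint measurability in the starting point and the length. It lets
    [ae_exchange] convert an identity that holds for each length and almost
    every starting point. *)
Lemma measurable_segment_integral2 (i : 'I_k) (V : T -> R) : measurable_fun setT V ->
  measurable_fun setT (fun p : T * RT => segment_integral i V p.2 p.1).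
Proof.
move=> mV.
pose S : set (T * RT * RT) := [set p | 0 <= p.2] `&` [set p | p.2 <= p.1.2].
have mS : measurable S.
  apply: measurableI; apply: measurable_ler_set => //.
  exact: (measurableT_comp measurable_snd measurable_fst).
(* The parameters are the starting point, the length and the point of the
   segment; [S] keeps the last one between [0] and the length. *)
pose K (p : T * RT * RT) : R := V (addt (axis i p.2) p.1.1) * \1_S p.
have mK : measurable_fun setT K.
  apply: measurable_funM; last exact: measurable_indic.
  apply: measurableT_comp => //; apply: measurable_addt.
    by apply: measurableT_comp => //; exact: measurable_axis.
  exact: (measurableT_comp measurable_fst measurable_fst).
have mKE : measurable_fun setT (EFin \o K) by exact/measurable_EFinP.
rewrite (_ : (fun p => _) = fine \o (fun p =>
    \int[leb]_s ((EFin \o K)^\+ (p, s)) - \int[leb]_s ((EFin \o K)^\- (p, s)))%E).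
  apply: measurableT_comp => //; apply: emeasurable_funB.
    apply: (@measurable_fun_fubini_tonelli_F _ _ _ _ _ leb ((EFin \o K)^\+)%E) => //.
    exact: measurable_funepos.
  apply: (@measurable_fun_fubini_tonelli_F _ _ _ _ _ leb ((EFin \o K)^\-)%E) => //.
  exact: measurable_funeneg.
apply/funext => -[y s] /=; rewrite /segment_integral Rintegral_indic /Rintegral.
have -> : (fun x : RT => (V (addt (axis i x) y) * \1_(seg s) x)%:E) =
    (EFin \o K) \o (fun x => (y, s, x)).
  apply/funext => t; rewrite /K/= !indicE; congr (_ * (nat_of_bool _)%:R)%:E.
  rewrite /S /seg; apply/idP/idP; rewrite !inE/= in_itv/=.
    by move=> /andP[].
  by move=> [-> ->].
by rewrite integralE funepos_comp funeneg_comp.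
Qed.

(** The infimum of the sequence has integral [0]. *)
Lemma ae_exists_small (D : set T) (f : nat -> T -> \bar R) : measurable D ->
  (forall m, measurable_fun D (f m)) -> (forall m x, 0 <= f m x)%E ->
  (forall e : R, 0 < e -> exists m, (\int[lam]_(x in D) f m x <= e%:E)%E) ->
  {ae lam, forall x, D x -> forall e : R, 0 < e -> exists m, (f m x < e%:E)%E}.
Proof.
move=> mD mf f0 fe.
pose g x := einfs (f ^~ x) 0%N.
have mg : measurable_fun D g by exact: measurable_fun_einfs.
have g0 x : (0 <= g x)%E by apply: le_ereal_inf_tmp => _ [m _ <-].
have gf m x : (g x <= f m x)%E by apply: ereal_inf_lbound; exists m.
have int0 : (\int[lam]_(x in D) g x = 0)%E.
  apply/eqP; rewrite eq_le integral_ge0// andbT.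
  apply/lee_addgt0Pr => e e0; rewrite add0e.
  have [m hm] := fe _ e0; apply: le_trans hm.
  exact: ge0_le_integral.
have : ae_eq lam D g (cst 0%E).
  apply/(ae_eq_integral_abs lam mD mg).
  by under eq_integral do rewrite gee0_abs//.
apply: filterS => x h /h gx0 e e0.
have : (g x < e%:E)%E by rewrite gx0 lte_fin.
by move=> /ereal_inf_lt[_ [m _ <-] ?]; exists m.
Qed.

(** Extended real values avoid any integrability condition on the segment; a
    bound by a real number restores it. *)
Definition osc (i : 'I_k) (V : T -> R) (z : T) (r : R) (x : T) : \bar R :=
  (\int[leb]_(s in seg r) `|V (addt (axis i s) (addt z x)) - V x|%:E)%E.

Lemma osc_ge0 i V z r x : (0 <= osc i V z r x)%E.
Proof. by apply: integral_ge0. Qed.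

Lemma measurable_osc_integrand i (V : T -> R) z : measurable_fun setT V ->
  measurable_fun setT (fun p : T * RT => `|V (addt (axis i p.2) (addt z p.1)) - V p.1|).
Proof.
move=> mV; apply: measurableT_comp => //; apply: measurable_funB.
  exact: measurable_axis_shift.
exact: measurableT_comp.
Qed.

Lemma measurable_osc i (V : T -> R) z r : measurable_fun setT V ->
  measurable_fun setT (osc i V z r).
Proof.
move=> mV.
pose F (p : T * RT) := (`|V (addt (axis i p.2) (addt z p.1)) - V p.1| * \1_(seg r) p.2)%:E.
rewrite (_ : osc i V z r = fun x => \int[leb]_s F (x, s))%E.
  apply: (@measurable_fun_fubini_tonelli_F _ _ _ _ _ leb F).
    apply/measurable_EFinP; apply: measurable_funM; first exact: measurable_osc_integrand.
    by apply: measurableT_comp => //; exact: measurable_indic (measurable_seg r).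
  by move=> p; rewrite lee_fin mulr_ge0.
apply/funext => x; rewrite /osc integral_mkcond; apply: eq_integral => s _.
by rewrite patchE /F/= indicE; case: ifP => _; rewrite ?mulr1 ?mulr0.
Qed.

(** By Fubini's theorem, this is the average over the segment of the mean
    change of [V] under a small translation. *)
Lemma integral_osc_le i (V : T -> R) (a b : 'I_k -> R) (d e r : R) z :
  measurable_fun setT V -> 0 <= r ->
  (forall z, small_shift d z -> (\int[lam]_(x in box a b) `|V (addt z x) - V x|%:E <= e%:E)%E) ->
  (forall s, seg r s -> small_shift d (addt (axis i s) z)) ->
  (\int[lam]_(x in box a b) osc i V z r x <= (r * e)%:E)%E.
Proof.
move=> mV r0 hd small.
have mB : measurable (box a b : set T) by exact: measurable_box.
pose F (p : T * RT) := (`|V (addt (axis i p.2) (addt z p.1)) - V p.1| * \1_(seg r) p.2 *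
  \1_(box a b) p.1)%:E.
have F0 p : (0 <= F p)%E by rewrite lee_fin !mulr_ge0.
have mF : measurable_fun setT F.
  apply/measurable_EFinP; apply: measurable_funM.
    apply: measurable_funM; first exact: measurable_osc_integrand.
    by apply: measurableT_comp => //; exact: measurable_indic (measurable_seg r).
  by apply: measurableT_comp => //; exact: measurable_indic.
have -> : (\int[lam]_(x in box a b) osc i V z r x = \int[lam]_x \int[leb]_s F (x, s))%E.
  rewrite integral_mkcond; apply: eq_integral => x _; rewrite patchE.
  rewrite /F /=; case: ifP => xB.
    rewrite /osc integral_mkcond; apply: eq_integral => s _.
    by rewrite patchE !indicE xB mulr1; case: ifP => _; rewrite ?mulr1 ?mulr0.
  by under eq_integral do rewrite !indicE xB mulr0; rewrite integral0.
rewrite (@fubini_tonelli _ _ _ _ _ lam leb F mF F0).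
apply: (@le_trans _ _ (\int[leb]_(s in seg r) e%:E)%E); last first.
  rewrite -EFin_Rintegral//; [|exact: measurable_seg|exact: integrable_cst_seg].
  by rewrite Rintegral_seg_cst.
have mr := measurable_seg r.
rewrite [leRHS]integral_mkcond; apply: ge0_le_integral => //.
- by move=> s _; exact: integral_ge0.
- exact: measurable_fun_fubini_tonelli_G.
- by apply/(measurable_restrictT _ mr); exact: measurable_cst.
move=> s _; rewrite patchE; case: ifPn => [sr|/negbTE sr].
  move: (sr); rewrite inE => /small/hd; apply: le_trans.
  rewrite [leRHS]integral_mkcond le_eqVlt; apply/orP; left; apply/eqP.
  apply: eq_integral => x _; rewrite patchE /F/= !indicE sr mulr1 addtA.
  by case: ifP => _; rewrite ?mulr1 ?mulr0.
by under eq_integral do rewrite /F/= indicE sr mulr0 mul0r; rewrite integral0.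
Qed.

End ae_tools.

(** * The area form vanishes on a box *)

Lemma adde4_ge (R : realType) (a b c d : \bar R) :
  (0 <= a)%E -> (0 <= b)%E -> (0 <= c)%E -> (0 <= d)%E ->
  [/\ a <= a + b + c + d, b <= a + b + c + d, c <= a + b + c + d, d <= a + b + c + d &
      0 <= a + b + c + d]%E.
Proof.
move=> a0 b0 c0 d0.
have ab0 := adde_ge0 a0 b0; have abc0 := adde_ge0 ab0 c0; have abcd0 := adde_ge0 abc0 d0.
split => //.
- by rewrite -!addeA leeDl// !adde_ge0.
- by rewrite [(a + b)%E]addeC -!addeA leeDl// !adde_ge0.
- by rewrite [(a + b + c)%E]addeC -addeA leeDl// adde_ge0.
- by rewrite leeDr.
Qed.

Section local.
Context {R : realType} {k n : nat}.
Local Notation RT := (measurableTypeR R).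
Local Notation T := (k.-tuple RT).
Local Notation lam := (@tuple_lebesgue R k).
Local Notation leb := (@lebesgue_measure R).
Local Notation comp := ('I_(2 * n).+1).
Variables (U : comp -> T -> R) (V : 'I_k -> comp -> T -> R).
Hypothesis iU : forall c, lam.-integrable setT (EFin \o U c).
Hypothesis iV : forall i c, lam.-integrable setT (EFin \o V i c).
Variables (A B : 'I_k -> R).
Hypothesis UV : forall i c, weak_on_box A B i (U c) (V i c).
Hypothesis ctc : {ae lam, forall x, box A B x -> forall i, contact_at U V i x}.

Let mU c : measurable_fun setT (U c). Proof. exact: integrable_measurable (iU c). Qed.
Let mV i c : measurable_fun setT (V i c). Proof. exact: integrable_measurable (iV i c). Qed.

Lemma box_axis_shift (a b : 'I_k -> R) i (s r : R) (x : T) : 0 <= s <= r ->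
  (forall j, A j <= a j) -> (forall j, b j + r <= B j) ->
  box a b x -> box A B (addt (axis i s) x).
Proof.
move=> /andP[s0 sr] Aa bB Dx j; rewrite !tnth_mktuple.
have := Dx j; have := Aa j; have := bB j; case: (j == i) => h1 h2 /andP[h3 h4].
  by apply/andP; split; lra.
by apply/andP; split; lra.
Qed.

(** [weak_difference] holds for each length and almost every starting point,
    and the contact equation at almost every point. Exchanging the order of the
    two quantifiers gives statements along almost every segment. *)
Lemma ae_good_side (a b : 'I_k -> R) i (r d : R) : 0 < r -> 0 < d ->
  (forall j, A j <= a j) -> (forall j, a j <= b j) -> (forall j, b j + r + d <= B j) ->
  {ae lam, forall x, box a b x -> good_side U V i r x}.
Proof.
move=> r0 d0 Aa ab bB.
have mb : measurable (box a b : set T) by exact: measurable_box.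
have wd c s : 0 < s <= r -> {ae lam, forall x, box a b x ->
    U c (addt (axis i s) x) - U c x = segment_integral i (V i c) s x}.
  move=> /andP[s0 sr].
  have bBs j : b j + s + d <= B j by apply: le_trans (bB j); rewrite !lerD2r lerD2l.
  exact: (weak_difference s0 d0 Aa ab bBs (iU c) (iV i c) (@UV i c)).
have ends : {ae lam, forall x, forall c, box a b x ->
    U c (addt (axis i r) x) - U c x = segment_integral i (V i c) r x}.
  by apply: filter_forall => c; apply: wd; rewrite r0 lexx.
have prim : {ae lam, forall x, forall c, {ae leb, forall s, box a b x -> 0 < s <= r ->
    U c (addt (axis i s) x) - U c x = segment_integral i (V i c) s x}}.
  apply: filter_forall => c.
  pose diff (p : T * RT) := U c (addt (axis i p.2) p.1) - U c p.1 - segment_integral i (V i c) p.2 p.1.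
  have mdiff : measurable_fun setT diff.
    apply: measurable_funB; last exact: measurable_segment_integral2.
    apply: measurable_funB; last exact: measurableT_comp.
    apply: measurableT_comp => //; apply: measurable_addt => //.
    by apply: measurableT_comp => //; exact: measurable_axis.
  pose E := diff @^-1` (~` [set 0]) `&` (box a b `*` `]0, r]).
  have mE : measurable E.
    apply: measurableI; last by apply: measurableX.
    by apply: measurable_preimageT => //; exact: measurableC.
  have := @ae_exchange _ _ E mE.
  have E0 s : lam (ysection E s) = 0%E.
    have [sr|sr] := boolP (0 < s <= r); last first.
      rewrite (_ : ysection E s = set0) ?measure0//; apply/seteqP; split => // x.
      by rewrite /ysection/= inE => -[_ [_ /=]]; rewrite in_itv/= (negbTE sr).
    have [N [mN N0 hN]] := wd c s sr.
    apply/eqP; rewrite eq_le measure_ge0 andbT -N0; apply: le_measure; rewrite ?inE//.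
      exact: measurable_ysection.
    move=> x; rewrite /ysection/= inE => -[/= h [/= bx _]]; apply: hN => /= /(_ bx) h'.
    by apply: h; rewrite /diff/= h' subrr.
  move=> /(_ E0); apply: filterS => x; apply: filterS => s Es bx sr.
  apply: contrapT => h; apply: Es; split => /=; last by rewrite in_itv.
  by move=> /eqP; rewrite subr_eq0 => /eqP.
have intV : {ae lam, forall x, forall c,
    leb.-integrable (seg r) (EFin \o (fun s => V i c (addt (axis i s) x)))}.
  apply: filter_forall => c.
  have := ae_integrable1 (integrable_axis_shift i r (iV i c) (axis i 0)).
  apply: filterS => x h.
  apply/(integrable_mkcond _ (measurable_seg r)) => //.
  apply: eq_integrable h => // s _ /=.
  rewrite add0t patchE indicE; case: ifP => _; rewrite ?mulr1 ?mulr0//.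
have cts : {ae lam, forall x, {ae leb, forall s, box a b x -> seg r s ->
    contact_at U V i (addt (axis i s) x)}}.
  have [N [mN N0 hN]] := ctc.
  pose E := [set p : T * RT | N (addt (axis i p.2) p.1)].
  have mE : measurable E.
    apply: (@measurable_preimageT _ _ _ _ (fun p : T * RT => addt (axis i p.2) p.1)) => //.
    apply: measurable_addt => //.
    by apply: measurableT_comp => //; exact: measurable_axis.
  have := @ae_exchange _ _ E mE.
  have E0 s : lam (ysection E s) = 0%E.
    rewrite (_ : ysection E s = addt (axis i s) @^-1` N); first by rewrite tuple_lebesgue_shift.
    by apply/seteqP; split => x; rewrite /ysection/= inE.
  move=> /(_ E0); apply: filterS => x; apply: filterS => s Es bx sr.
  apply: contrapT => h; apply: Es; apply: hN => /= H; apply: h; apply: H.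
  have s0r : 0 <= s <= r by move: sr; rewrite /seg /= in_itv.
  have bBr j : b j + r <= B j by apply: le_trans (bB j); rewrite lerDl ltW.
  exact: (box_axis_shift i s0r Aa bBr bx).
apply: filterS2 (filterI ends prim) (filterI intV cts) => x [x1 x2] [x3 x4] bx; split.
- by move=> c; exact: x1.
- move=> c; move: (x2 c); apply: (@filterS _ _ (ae_filter_ringOfSetsType leb)) => s h; rewrite /seg/= in_itv/= => /andP[].
  rewrite le_eqVlt => /predU1P[<-|s0] sr; last by apply: h => //; rewrite s0.
  by rewrite add0t subrr /segment_integral /seg set_itv1 Rintegral_set1.
- by [].
- by move: x4; apply: (@filterS _ _ (ae_filter_ringOfSetsType leb)) => s; apply.
Qed.

Definition loop_osc (i j : 'I_k) (r : R) (x : T) : \bar R :=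
  (\sum_(c : comp) (osc i (V i c) (axis i 0) r x + osc j (V j c) (axis i r) r x
     + osc i (V i c) (axis j r) r x + osc j (V j c) (axis j 0) r x))%E.

Lemma osc_lt i c z r (e : R) x : leb.-integrable (seg r) (EFin \o (fun s => V i c (addt (axis i s) (addt z x)))) ->
  (osc i (V i c) z r x < e%:E)%E ->
  \int[leb]_(s in seg r) `|V i c (addt (axis i s) (addt z x)) - V i c x| <= e.
Proof.
move=> h1 h2; rewrite -lee_fin EFin_Rintegral; [exact: ltW|exact: measurable_seg|].
apply: integrable_norm; apply: integrableRB h1 _; first exact: measurable_seg.
exact: integrable_cst_seg.
Qed.

Lemma loop_osc_lt (i j : 'I_k) (r e : R) (x : T) :
  good_side U V i r x -> good_side U V j r (addt (axis i r) x) ->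
  good_side U V i r (addt (axis j r) x) -> good_side U V j r x ->
  (loop_osc i j r x < e%:E)%E -> good_loop U V i j r e x.
Proof.
move=> g1 g2 g3 g4 lt.
have [_ _ h1 _] := g1; have [_ _ h2 _] := g2; have [_ _ h3 _] := g3; have [_ _ h4 _] := g4.
have quad c := adde4_ge (osc_ge0 i (V i c) (axis i 0) r x) (osc_ge0 j (V j c) (axis i r) r x)
  (osc_ge0 i (V i c) (axis j r) r x) (osc_ge0 j (V j c) (axis j 0) r x).
have ltc c : (osc i (V i c) (axis i 0) r x + osc j (V j c) (axis i r) r x
     + osc i (V i c) (axis j r) r x + osc j (V j c) (axis j 0) r x < e%:E)%E.
  apply: le_lt_trans lt; rewrite /loop_osc (bigD1 c)//= leeDl//.
  by apply: sume_ge0 => c' _; have [] := quad c'.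
split; split => // c; have [q1 q2 q3 q4 _] := quad c.
- have := @osc_lt i c (axis i 0) r e x; rewrite add0t; apply; first exact: h1.
  exact: le_lt_trans q1 (ltc c).
- apply: osc_lt; first exact: h2.
  exact: le_lt_trans q2 (ltc c).
- apply: osc_lt; first exact: h3.
  exact: le_lt_trans q3 (ltc c).
- have := @osc_lt j c (axis j 0) r e x; rewrite add0t; apply; first exact: h4.
  exact: le_lt_trans q4 (ltc c).
Qed.

Lemma measurable_loop_osc i j r : measurable_fun setT (loop_osc i j r).
Proof.
apply: emeasurable_sum => c.
have m1 := measurable_osc i (axis i 0) r (mV i c).
have m2 := measurable_osc j (axis i r) r (mV j c).
have m3 := measurable_osc i (axis j r) r (mV i c).
have m4 := measurable_osc j (axis j 0) r (mV j c).
exact: (emeasurable_funD (emeasurable_funD (emeasurable_funD m1 m2) m3) m4).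
Qed.

Lemma loop_osc_ge0 i j r x : (0 <= loop_osc i j r x)%E.
Proof.
apply: sume_ge0 => c _.
by have [] := adde4_ge (osc_ge0 i (V i c) (axis i 0) r x) (osc_ge0 j (V j c) (axis i r) r x)
  (osc_ge0 i (V i c) (axis j r) r x) (osc_ge0 j (V j c) (axis j 0) r x).
Qed.

Lemma common_L1_shift (a b : 'I_k -> R) i (e : R) : (forall j, a j <= b j) -> 0 < e ->
  exists2 d, 0 < d & forall c (z : T), small_shift d z ->
    (\int[lam]_(x in box a b) `|V i c (addt z x) - V i c x|%:E <= e%:E)%E.
Proof.
move=> ab e0.
have /choice[f hf] : forall c, exists d, 0 < d /\ forall z : T, small_shift d z ->
    (\int[lam]_(x in box a b) `|V i c (addt z x) - V i c x|%:E <= e%:E)%E.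
  by move=> c; have [d d0 hd] := L1_shift_continuous ab e0 (mV i c) (iV i c); exists d.
exists (\big[Num.min/1]_c f c).
  by apply: lt_bigmin => // c _; have [] := hf c.
move=> c z hz; have [_] := hf c; apply; apply: small_shift_le hz.
exact: bigmin_le_cond.
Qed.

Lemma small_shift_axis (i j : 'I_k) (s r d : R) : 0 <= s <= r -> r + r <= d ->
  small_shift d (addt (axis i s) (axis j r)) /\ small_shift d (addt (axis i s) (axis j 0)).
Proof.
move=> /andP[s0 sr] rd; split => l; rewrite !tnth_mktuple; case: (l == i); case: (l == j);
  by apply/andP; split; lra.
Qed.

Lemma integral_loop_osc_le (a b : 'I_k -> R) i j (e : R) : (forall j, a j <= b j) -> 0 < e ->
  exists2 d, 0 < d & forall r, 0 < r <= d ->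
    (\int[lam]_(x in box a b) loop_osc i j r x <= (r * e)%:E)%E.
Proof.
move=> ab e0; (* One oscillation for each of the four sides and each component. *)
pose N := 4 * (2 * n).+1%:R : R.
have N0 : 0 < N by rewrite mulr_gt0// ltr0n.
have eN0 : 0 < e / N by rewrite divr_gt0.
have [d1 d10 h1] := common_L1_shift i ab eN0.
have [d2 d20 h2] := common_L1_shift j ab eN0.
exists (Num.min d1 d2 / 2); first by rewrite divr_gt0// lt_min d10.
move=> r /andP[r0 rd].
have [rd1 rd2] : r + r <= d1 /\ r + r <= d2.
  have := rd; rewrite ler_pdivlMr// mulr_natr mulr2n => h.
  by split; rewrite (le_trans h)// ge_min lexx ?orbT.
have mB : measurable (box a b : set T) by exact: measurable_box.
have mo l V' z : measurable_fun setT V' -> measurable_fun (box a b : set T) (osc l V' z r).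
  by move=> mV'; apply: measurable_funTS; exact: measurable_osc.
have seg_itv s : seg r s -> 0 <= s <= r by rewrite /seg/= in_itv.
have o1 c : (\int[lam]_(x in box a b) osc i (V i c) (axis i 0) r x <= (r * (e / N))%:E)%E.
  apply: (integral_osc_le (mV i c) (ltW r0) (h1 c)) => s /seg_itv sr.
  by have [_] := small_shift_axis i i sr rd1.
have o2 c : (\int[lam]_(x in box a b) osc j (V j c) (axis i r) r x <= (r * (e / N))%:E)%E.
  apply: (integral_osc_le (mV j c) (ltW r0) (h2 c)) => s /seg_itv sr.
  by have [] := small_shift_axis j i sr rd2.
have o3 c : (\int[lam]_(x in box a b) osc i (V i c) (axis j r) r x <= (r * (e / N))%:E)%E.
  apply: (integral_osc_le (mV i c) (ltW r0) (h1 c)) => s /seg_itv sr.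
  by have [] := small_shift_axis i j sr rd1.
have o4 c : (\int[lam]_(x in box a b) osc j (V j c) (axis j 0) r x <= (r * (e / N))%:E)%E.
  apply: (integral_osc_le (mV j c) (ltW r0) (h2 c)) => s /seg_itv sr.
  by have [_] := small_shift_axis j j sr rd2.
pose Q c x := (osc i (V i c) (axis i 0) r x + osc j (V j c) (axis i r) r x
     + osc i (V i c) (axis j r) r x + osc j (V j c) (axis j 0) r x)%E.
have Q0 c x : (0 <= Q c x)%E.
  by have [] := adde4_ge (osc_ge0 i (V i c) (axis i 0) r x) (osc_ge0 j (V j c) (axis i r) r x)
    (osc_ge0 i (V i c) (axis j r) r x) (osc_ge0 j (V j c) (axis j 0) r x).
have mQ c : measurable_fun (box a b : set T) (Q c).
  have m1 := mo i _ (axis i 0) (mV i c); have m2 := mo j _ (axis i r) (mV j c).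
  have m3 := mo i _ (axis j r) (mV i c); have m4 := mo j _ (axis j 0) (mV j c).
  exact: (emeasurable_funD (emeasurable_funD (emeasurable_funD m1 m2) m3) m4).
have intQ c : (\int[lam]_(x in box a b) Q c x <= (4 * (r * (e / N)))%:E)%E.
  have m1 := mo i _ (axis i 0) (mV i c); have m2 := mo j _ (axis i r) (mV j c).
  have m3 := mo i _ (axis j r) (mV i c); have m4 := mo j _ (axis j 0) (mV j c).
  have ge12 x : (0 <= osc i (V i c) (axis i 0) r x + osc j (V j c) (axis i r) r x)%E.
    exact: adde_ge0 (osc_ge0 _ _ _ _ _) (osc_ge0 _ _ _ _ _).
  have ge123 x : (0 <= osc i (V i c) (axis i 0) r x + osc j (V j c) (axis i r) r x
     + osc i (V i c) (axis j r) r x)%E.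
    exact: adde_ge0 (ge12 x) (osc_ge0 _ _ _ _ _).
  have m12 := emeasurable_funD m1 m2; have m123 := emeasurable_funD m12 m3.
  rewrite /Q (ge0_integralD lam mB (fun x _ => ge123 x) m123 (fun x _ => osc_ge0 _ _ _ _ x) m4).
  rewrite (ge0_integralD lam mB (fun x _ => ge12 x) m12 (fun x _ => osc_ge0 _ _ _ _ x) m3).
  rewrite (ge0_integralD lam mB (fun x _ => osc_ge0 _ _ _ _ x) m1 (fun x _ => osc_ge0 _ _ _ _ x) m2).
  apply: (le_trans (leeD (leeD (leeD (o1 c) (o2 c)) (o3 c)) (o4 c))).
  rewrite -!EFinD lee_fin le_eqVlt; apply/orP; left; apply/eqP; ring.
rewrite /loop_osc ge0_integral_sum//; last by move=> c x _; exact: Q0.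
apply: (@le_trans _ _ (\sum_(c : comp) (4 * (r * (e / N)))%:E)%E).
  by apply: lee_sum => c _; exact: intQ.
rewrite sumEFin lee_fin sumr_const card_ord -mulr_natl le_eqVlt; apply/orP; left; apply/eqP.
rewrite [RHS](_ : _ = N * (r * (e / N))); first by rewrite /N; ring.
by rewrite mulrCA [N * _]mulrC divfK// gt_eqF.
Qed.

Lemma eq0_of_small_ratio (w C : R) : 0 <= C -> (forall e, 0 < e <= 1 -> `|w| <= C * e) -> w = 0.
Proof.
move=> C0 h; apply/eqP; rewrite -normr_le0 leNgt; apply/negP => w0.
have C1 : 0 < C + 1 by rewrite ltr_wpDl.
have e0 : 0 < Num.min 1 (`|w| / (2 * (C + 1))).
  by rewrite lt_min ltr01/= divr_gt0// mulr_gt0.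
have := h (Num.min 1 (`|w| / (2 * (C + 1)))).
rewrite e0 ge_min lexx => /(_ isT) le1.
have : C * Num.min 1 (`|w| / (2 * (C + 1))) <= (C + 1) * (`|w| / (2 * (C + 1))).
  apply: ler_pM => //; first exact: ltW.
    by rewrite lerDl.
  by rewrite ge_min lexx orbT.
rewrite [leRHS](_ : _ = `|w| / 2); last by field; rewrite gt_eqF.
by move=> /(le_trans le1); rewrite leNgt ltr_pdivrMr// ltr_pMr// ltr1n.
Qed.

(** For almost every [x] and every [e > 0], some length in the sequence [r m]
    gives a parallelogram whose sides are good and whose oscillation is at most
    [r m * e]. Then [loop_estimate] bounds the area form by a multiple of [e]. *)
Theorem area_form_vanishes (a b : 'I_k -> R) (rho d : R) : 0 < rho -> 0 < d ->
  (forall j, A j <= a j) -> (forall j, a j <= b j) ->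
  (forall j, b j + rho + rho + d <= B j) ->
  {ae lam, forall x, box a b x -> forall i j,
    area_form (V i ^~ x) (V j ^~ x) = 0}.
Proof.
move=> rho0 d0 Aa ab bB.
suff : {ae lam, forall x, forall i j, box a b x -> area_form (V i ^~ x) (V j ^~ x) = 0}.
  by apply: filterS => x h bx i j; exact: h.
apply: filter_forall => i; apply: filter_forall => j.
(* The second and third sides start at a vertex shifted by at most [rho]. *)
pose b' l := b l + rho.
have ab' l : a l <= b' l by rewrite (le_trans (ab l))// lerDl ltW.
pose r m : R := rho / m.+1%:R.
have r0 m : 0 < r m by rewrite divr_gt0// ltr0n.
have rrho m : r m <= rho by rewrite ler_pdivrMr ?ltr0n// ler_peMr ?ler1n// ltW.
have bbr m l : b' l + r m + d <= B l.
  by apply: le_trans (bB l); rewrite lerD2r lerD2l.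
have good m l := ae_good_side l (r0 m) d0 Aa ab' (bbr m).
have goods : {ae lam, forall x m, box a b x ->
   [/\ good_side U V i (r m) x, good_side U V j (r m) (addt (axis i (r m)) x),
       good_side U V i (r m) (addt (axis j (r m)) x) & good_side U V j (r m) x]}.
  apply: ae_foralln => m.
  apply: filterS2 (filterI (good m i) (ae_shift (axis i (r m)) (good m j)))
    (filterI (ae_shift (axis j (r m)) (good m i)) (good m j)) => x [g1 g2] [g3 g4] bx.
  have sub l : box a b' (addt (axis l (r m)) x).
    move=> l'; rewrite !tnth_mktuple; have := bx l'; have := r0 m; have := rrho m; rewrite /b'.
    move=> h1 h2 /andP[h3 h4]; clear -h1 h2 h3 h4 rho0.
    by case: (l' == l); apply/andP; split; lra.
  have bx' : box a b' x.
    by move=> l; have /andP[h1 h2] := bx l; rewrite h1 (lt_le_trans h2)// lerDl ltW.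
  by split; [exact: g1|exact: g2|exact: g3|exact: g4].
pose f m x := (((r m)^-1)%:E * loop_osc i j (r m) x)%E.
have rV0 m : (0 <= ((r m)^-1)%:E)%E by rewrite lee_fin invr_ge0 ltW.
have mB : measurable (box a b : set T) by exact: measurable_box.
have mf m : measurable_fun (box a b : set T) (f m).
  apply: emeasurable_funM; first exact: measurable_cst.
  by apply: measurable_funTS; exact: measurable_loop_osc.
have f0 m x : (0 <= f m x)%E by apply: mule_ge0 => //; exact: loop_osc_ge0.
have fe (e : R) : 0 < e -> exists m, (\int[lam]_(x in box a b) f m x <= e%:E)%E.
  move=> e0; have [dd dd0 hd] := integral_loop_osc_le i j ab e0.
  have [m hm] : exists m, r m <= dd.
    exists (Num.truncn (rho / dd)); rewrite /r ler_pdivrMr ?ltr0n//.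
    rewrite mulrC -ler_pdivrMr//; apply: ltW; exact: truncnS_gt.
  exists m; rewrite /f ge0_integralZl//.
  - apply: (@le_trans _ _ (((r m)^-1)%:E * (r m * e)%:E)%E).
      by rewrite lee_wpmul2l//; apply: hd; rewrite r0.
    by rewrite -EFinM mulKf// gt_eqF.
  - by apply: measurable_funTS; exact: measurable_loop_osc.
  - by move=> x _; exact: loop_osc_ge0.
have small := ae_exists_small mB mf f0 fe.
apply: filterS2 goods small => x gx sx bx.
pose M := \sum_(c : comp) (`|V i c x| + `|V j c x|).
have M0 : 0 <= M by apply: sumr_ge0 => c _; rewrite addr_ge0.
have MV c : `|V i c x| + `|V j c x| <= M.
  by rewrite /M (bigD1 c)//= lerDl; apply: sumr_ge0 => c' _; rewrite addr_ge0.
have iM c : `|V i c x| <= M by apply: le_trans (MV c); rewrite lerDl.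
have jM c : `|V j c x| <= M by apply: le_trans (MV c); rewrite lerDr.
apply: (@eq0_of_small_ratio _ (n%:R * (6 * (2 * M + 1)))).
  by rewrite !mulr_ge0// addr_ge0// mulr_ge0.
move=> e /andP[e0 e1]; have [m fm] := sx bx e e0.
have [g1 g2 g3 g4] := gx m bx.
have osclt : (loop_osc i j (r m) x < (r m * e)%:E)%E.
  by move: fm; rewrite /f muleC lte_pdivrMr// EFinM muleC.
have loop := loop_osc_lt g1 g2 g3 g4 osclt.
have := loop_estimate mU (ltW (r0 m)) loop iM jM.
move=> est; rewrite -(ler_pM2l (exprn_gt0 2 (r0 m))).
apply: (le_trans est).
rewrite [leLHS](_ : _ = (r m ^+ 2 * (n%:R * 6)) * (2 * M * e + e * e)); last by ring.
rewrite [leRHS](_ : _ = (r m ^+ 2 * (n%:R * 6)) * (2 * M * e + 1 * e)); last by ring.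
have c0 : 0 <= r m ^+ 2 * (n%:R * 6) by exact: mulr_ge0 (sqr_ge0 _) (mulr_ge0 _ _).
apply: (ler_wpM2l c0).
by rewrite lerD2l ler_wpM2r// ltW.
Qed.

End local.

(** * Borel representatives of Lebesgue measurable functions *)

Section transfer.
Context {R : realType} {k : nat}.
Local Notation RT := (measurableTypeR R).
Local Notation T := (k.-tuple RT).
Local Notation lam := (@tuple_lebesgue R k).
Local Notation mu := (@lebesgue_rV R k).
Local Notation X := (caratheodory_type (@lebesgue_outer R k)).
Local Notation tau := (@tuple_of_rV R k : X -> T).

Lemma measurable_tuple_of_rV : measurable_fun setT tau.
Proof. by move=> _ A mA; rewrite setTI; have [] := lebesgue_rVE mA. Qed.

Lemma lebesgue_rV_preimage A : measurable A -> mu (tau @^-1` A) = lam A.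
Proof. by move=> mA; have [] := lebesgue_rVE mA. Qed.

Lemma tuple_of_rVK (t : T) : tau (\row_j tnth t j) = t.
Proof. by apply: eq_from_tnth => j; rewrite tnth_mktuple mxE. Qed.

Lemma ae_lebesgue_rV (P : T -> Prop) :
  {ae lam, forall t, P t} -> {ae mu, forall x, P (tau x)}.
Proof.
move=> [N [mN N0 PN]]; exists (tau @^-1` N); split.
- by apply: measurable_preimageT mN; exact: measurable_tuple_of_rV.
- by rewrite -N0; exact: lebesgue_rV_preimage.
- by move=> x Px; apply: PN.
Qed.

Lemma eq_integral_pushforward (f : T -> \bar R) mtau :
  (\int[measure_function_pushforward__canonical__measure_function_Measure mu (f := tau) mtau]_t f t
   = \int[lam]_t f t)%E.
Proof.
by apply: (eq_measure_integral lam) => A mA _; exact: lebesgue_rV_preimage.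
Qed.

Lemma ge0_integral_lebesgue_rV (f : T -> \bar R) :
  measurable_fun setT f -> (forall t, 0 <= f t)%E ->
  (\int[lam]_t f t = \int[mu]_x f (tau x))%E.
Proof.
move=> mf f0; rewrite -(eq_integral_pushforward f measurable_tuple_of_rV).
exact: (ge0_integral_pushforward measurable_tuple_of_rV mu measurableT).
Qed.

Lemma integral_lebesgue_rV (f : T -> \bar R) : lam.-integrable setT f ->
  mu.-integrable setT (f \o tau) /\ (\int[lam]_t f t = \int[mu]_x f (tau x))%E.
Proof.
move=> /integrableP[mf fi].
have ift : mu.-integrable setT (f \o tau).
  apply/integrableP; split; first exact: (measurableT_comp mf measurable_tuple_of_rV).
  rewrite -(@ge0_integral_lebesgue_rV (fun t => `|f t|%E))//.
  exact: measurableT_comp.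
split => //; rewrite -(eq_integral_pushforward f measurable_tuple_of_rV).
exact: (integral_pushforward measurable_tuple_of_rV mf ift measurableT).
Qed.

(** The intersection of countable measurable covers whose total measures
    approach the outer measure. *)
Lemma outer_hull (S : set T) : (mu_ext lam S < +oo)%E ->
  exists B, [/\ measurable B, S `<=` B & lam B = mu_ext lam S].
Proof.
move=> Soo.
have Sfin : mu_ext lam S \is a fin_num by rewrite ge0_fin_numE// mu_ext_ge0.
have approx (m : nat) : exists B, [/\ measurable B, S `<=` B &
    (lam B <= mu_ext lam S + (m.+1%:R^-1)%:E)%E].
  have e0 : 0 < m.+1%:R^-1 :> R by rewrite invr_gt0.
  have [_ [F cF <-] hF] := lb_ereal_inf_adherent e0 Sfin.
  exists (\bigcup_i F i); split.
  - by apply: bigcup_measurable => i _; exact: (cover_measurable cF).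
  - exact: (cover_subset cF).
  - apply: le_trans (ltW hF); apply: measure_sigma_subadditive => //.
    + by move=> i; exact: (cover_measurable cF).
    + by apply: bigcup_measurable => i _; exact: (cover_measurable cF).
have [B hB] := choice approx.
have mB : measurable (\bigcap_m B m) by apply: bigcap_measurable => // m _; have [] := hB m.
exists (\bigcap_m B m); split => //.
  by move=> t St m _; have [_ + _] := hB m; apply.
apply/eqP; rewrite eq_le; apply/andP; split.
  apply/lee_addgt0Pr => e e0.
  have [m hm] : exists m, m.+1%:R^-1 <= e.
    exists (Num.truncn e^-1); rewrite invf_ple ?posrE//; apply: ltW; exact: truncnS_gt.
  have [mBm _ le] := hB m.
  apply: (@le_trans _ _ (lam (B m))).
    by apply: le_measure; rewrite ?inE//; exact: bigcap_inf.
  by apply: (le_trans le); rewrite leeD2l// lee_fin.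
rewrite -(measurable_mu_extE lam mB); apply: le_mu_ext => t St m _.
by have [_ + _] := hB m; apply.
Qed.

(** A null set of the completed measure has a Borel hull that is null. *)
Lemma ae_tuple_lebesgue (P : X -> Prop) : {ae mu, forall x, P x} ->
  {ae lam, forall t, P (\row_j tnth t j)}.
Proof.
move=> [N [mN N0 PN]].
have N0' : mu_ext lam (tau @` N) = 0%E by exact: N0.
have [B [mB NB B0]] : exists B, [/\ measurable B, tau @` N `<=` B & lam B = mu_ext lam (tau @` N)].
  by apply: outer_hull; rewrite N0'.
exists B; split => //; first by rewrite B0.
move=> t /= Pt; apply: NB; exists (\row_j tnth t j); first exact: PN.
exact: tuple_of_rVK.
Qed.

Lemma measurable_hull (A : set X) : measurable A -> (mu A < +oo)%E ->
  exists B, [/\ measurable B, A `<=` tau @^-1` B & mu (tau @^-1` B `\` A) = 0%E].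
Proof.
move=> mA Aoo.
have [B [mB AB BA]] := @outer_hull (tau @` A) Aoo.
have AB' : A `<=` tau @^-1` B by move=> x Ax; apply: AB; exists x.
exists B; split => //.
have mtB : measurable (tau @^-1` B : set X) by apply: measurable_preimageT mB; exact: measurable_tuple_of_rV.
have muB : mu (tau @^-1` B) = mu A by rewrite lebesgue_rV_preimage.
have tBoo : (mu (tau @^-1` B) < +oo)%E by rewrite muB.
have -> : mu (tau @^-1` B `\` A) = (mu (tau @^-1` B) - mu (tau @^-1` B `&` A))%E.
  exact: measureD.
by rewrite setIidr// muB subee// ge0_fin_numE.
Qed.

Lemma ae_sup_rat (y : R) (q : nat -> R) (h : nat -> \bar R) :
  (forall m, h m = if q m < y then (q m)%:E else -oo%E) ->
  (forall x z : R, x < z -> exists m, x < q m < z) -> esups h 0%N = y%:E.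
Proof.
move=> hE dense; apply/eqP; rewrite eq_le; apply/andP; split.
  apply: ge_ereal_sup => _ [m _ <-]; rewrite hE.
  by case: ifP => [/ltW|_]; [rewrite lee_fin|exact: leNye].
apply/lee_subgt0Pr => e e0.
have [m /andP[h1 h2]] : exists m, y - e < q m < y by apply: dense; rewrite ltrBlDr ltrDl.
apply: (@le_trans _ _ (h m)); first by rewrite hE h2 -EFinB lee_fin ltW.
by apply: ereal_sup_ubound; exists m.
Qed.

Definition ratn (m : nat) : R := ratr (odflt 0 (unpickle m : option rat)).

Lemma ratn_dense (x z : R) : x < z -> exists m, x < ratn m < z.
Proof.
move=> /rat_in_itvoo[q]; rewrite in_itv/= => xqz.
by exists (pickle q); rewrite /ratn pickleK.
Qed.

(** The superlevel sets of [u] at rational heights are replaced by Borel hulls,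
    and [g] is at each point the supremum of the heights whose hull contains
    it. The two functions agree outside the countably many null differences. *)
Theorem borel_representative (Kt : set T) (u : X -> R) : measurable Kt ->
  (lam Kt < +oo)%E -> mu.-integrable (tau @^-1` Kt) (EFin \o u) ->
  exists g : T -> R, [/\ lam.-integrable setT (EFin \o g),
    {ae mu, forall x, Kt (tau x) -> g (tau x) = u x} & forall t, ~ Kt t -> g t = 0].
Proof.
move=> mKt Ktoo iu; set K := tau @^-1` Kt in iu.
have mtau := measurable_tuple_of_rV.
have mK : measurable K by apply: measurable_preimageT mKt.
have mu' : measurable_fun K u by apply/measurable_EFinP; exact: (measurable_int mu iu).
have mA m : measurable (K `&` [set x | ratn m < u x]).
  have := mu' mK `]ratn m, +oo[%classic (measurable_itv _).
  by congr measurable; congr (_ `&` _); apply/seteqP; split => x /=; rewrite in_itv/= andbT.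
have hull m : exists B, [/\ measurable B, K `&` [set x | ratn m < u x] `<=` tau @^-1` B &
    mu (tau @^-1` B `\` (K `&` [set x | ratn m < u x])) = 0%E].
  apply: measurable_hull => //.
  apply: (@le_lt_trans _ _ (mu K)); last by rewrite lebesgue_rV_preimage.
  by apply: le_measure; rewrite ?inE//; exact: subIsetl.
have [B hB] := choice hull.
have mB m : measurable (B m) by have [] := hB m.
pose h m (t : T) : \bar R := if t \in B m then (ratn m)%:E else -oo%E.
have mh m : measurable_fun setT (h m).
  apply: measurable_fun_ifT => //.
  apply: (@measurable_fun_bool _ _ _ _ true); rewrite setTI.
  rewrite (_ : _ @^-1` _ = B m)//.
  by apply/seteqP; split => t /=; [move=> /set_mem|move=> /mem_set].
pose g t := fine (esups (h ^~ t) 0%N) * \1_Kt t.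
have mg : measurable_fun setT g.
  apply: measurable_funM; last exact: measurable_indic.
  by apply: measurableT_comp => //; exact: measurable_fun_esups.
have aeg : {ae mu, forall x, Kt (tau x) -> g (tau x) = u x}.
  have : {ae mu, forall x m, ~ (tau @^-1` B m `\` (K `&` [set x | ratn m < u x])) x}.
    apply: ae_foralln => m; have [_ _ N0] := hB m.
    exists (tau @^-1` B m `\` (K `&` [set x | ratn m < u x])); split => //.
      by apply: measurableD => //; apply: measurable_preimageT (mB m).
    by move=> x /= /contrapT.
  apply: filterS => x hx Kx.
  rewrite /g indicE mem_set// mulr1 (@ae_sup_rat (u x) ratn)//; last exact: ratn_dense.
  move=> m; rewrite /h; congr (if _ then _ else _).
  have [_ AB _] := hB m.
  apply/idP/idP; rewrite inE.
    by move=> Bx; apply: contrapT => nux; apply: (hx m); split => // -[].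
  by move=> ux; apply: AB.
exists g; split => //; last first.
  by move=> t nKt; rewrite /g indicE memNset// mulr0.
apply/integrableP; split; first exact/measurable_EFinP.
rewrite (@ge0_integral_lebesgue_rV (fun t => `|(EFin \o g) t|%E))//; last first.
  by apply: measurableT_comp => //; exact/measurable_EFinP.
have -> : (\int[mu]_x `|(EFin \o g) (tau x)| = \int[mu]_(x in K) `|(EFin \o g) (tau x)|)%E.
  rewrite [RHS]integral_mkcond; apply: eq_integral => x _; rewrite patchE.
  by case: ifPn => // /negP; rewrite inE => nK; rewrite /= /g indicE memNset// mulr0 normr0.
have /integrableP[mEu] := iu; apply: le_lt_trans.
have m1 : measurable_fun K (fun x => `|(EFin \o g) (tau x)|%E).
  apply: measurable_funTS; apply: measurableT_comp => //.
  by apply/measurable_EFinP; exact: (measurableT_comp mg mtau).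
have m2 : measurable_fun K (fun x => `|(EFin \o u) x|%E) by exact: measurableT_comp.
have ae12 : ae_eq mu K (fun x => `|(EFin \o g) (tau x)|%E) (fun x => `|(EFin \o u) x|%E).
  by move: aeg; apply: filterS => x gu Kx; rewrite /= gu.
by rewrite (ge0_ae_eq_integral mK m1 m2 (fun x _ => abse_ge0 _) (fun x _ => abse_ge0 _) ae12).
Qed.

End transfer.

(** * Weak derivatives on a box contained in the domain *)

Section bridge.
Context {R : realType} {k : nat}.
Local Notation RT := (measurableTypeR R).
Local Notation T := (k.-tuple RT).
Local Notation lam := (@tuple_lebesgue R k).
Local Notation mu := (@lebesgue_rV R k).
Local Notation X := (caratheodory_type (@lebesgue_outer R k)).
Local Notation tau := (@tuple_of_rV R k : X -> T).

Lemma bounded_of_support (f : R -> R) (a b : R) : continuous f ->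
  (forall y, f y != 0 -> a <= y <= b) -> exists M, forall y, `|f y| <= M.
Proof.
move=> cf supp.
have [ab|ba] := leP a b; last first.
  exists 0 => y; have [->|/supp/andP[h1 h2]] := eqVneq (f y) 0; first by rewrite normr0.
  by have := lt_le_trans ba (le_trans h1 h2); rewrite ltxx.
have cnf : {within `[a, b], continuous (fun y => `|f y|)}.
  apply: continuous_subspaceT => y; apply: continuous_comp; first exact: cf.
  exact: norm_continuous.
have [c _ hc] := EVT_max ab cnf.
exists `|f c| => y; have [->|/supp h] := eqVneq (f y) 0; first by rewrite normr0.
by apply: hc; rewrite in_itv.
Qed.

Definition closed_box (A B : 'I_k -> R) : set T := [set t | forall j, A j <= tnth t j <= B j].

Lemma measurable_closed_box A B : measurable (closed_box A B).
Proof.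
rewrite (_ : closed_box A B = \big[setI/setT]_(j < k) ((@tnth k RT ^~ j) @^-1` `[A j, B j])); last first.
  rewrite -bigcap_seq; apply/seteqP; split => [x ax j _|x ax j]/=.
    by rewrite in_itv/= ax.
  by have := ax j (mem_index_enum _); rewrite /= in_itv.
apply: bigsetI_measurable => j _.
by apply: measurable_preimageT => //; exact: measurable_tnth.
Qed.

Lemma closed_box_lty A B : (forall j, A j <= B j) -> (lam (closed_box A B) < +oo)%E.
Proof.
move=> AB.
have le' j : A j - 1 <= B j + 1.
  by rewrite (le_trans _ (le_trans (AB j) _))// ?lerDl// gerBl.
apply: le_lt_trans (lam_box_lty le').
apply: le_measure; rewrite ?inE; [exact: measurable_closed_box|exact: measurable_box|].
move=> t h j; have /andP[h1 h2] := h j.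
by rewrite (lt_le_trans _ h1) ?gtrBl// (le_lt_trans h2)// ltrDl.
Qed.

Lemma compact_closed_box (A B : 'I_k -> R) :
  compact [set x : 'rV[R]_k | forall j, A j <= x 0 j <= B j].
Proof.
have := @rV_compact R k (fun j => `[A j, B j]%classic) (fun j => @segment_compact _ _ _).
congr compact; apply/seteqP; split => x h j; have := h j; by rewrite /= in_itv.
Qed.

Definition ttensor (G : 'I_k -> R -> R) (t : T) : R := \prod_j G j (tnth t j).

Lemma ttensor_tau G x : ttensor G (tau x) = tensor G x.
Proof. by apply: eq_bigr => j _; rewrite tnth_mktuple. Qed.

Variables (A B : 'I_k -> R).
Local Notation Kt := (closed_box A B).
Let mKt : measurable Kt. Proof. exact: measurable_closed_box. Qed.
Let mK : measurable (tau @^-1` Kt).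
Proof. by apply: measurable_preimageT mKt; exact: measurable_tuple_of_rV. Qed.

Lemma ttensor_bounded (G : 'I_k -> R -> R) : (forall j, continuous (G j)) ->
  (forall j y, G j y != 0 -> A j <= y <= B j) ->
  [/\ measurable_fun setT (ttensor G), exists M, forall t, `|ttensor G t| <= M &
      forall t, ~ Kt t -> ttensor G t = 0].
Proof.
move=> cG sG.
have [M hM] := choice (fun j => bounded_of_support (cG j) (sG j)).
split.
- apply: measurable_prod_fun => j; apply: measurableT_comp; last exact: measurable_tnth.
  by apply: continuous_measurable_fun; exact: cG.
- exists (\prod_j M j) => t; rewrite /ttensor normr_prod; apply: ler_prod => j _.
  by rewrite normr_ge0 hM.
- move=> t nKt; apply/eqP; apply: contrapT => /negP h; apply: nKt => j.
  by apply: sG; move/prodf_neq0: h; exact.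
Qed.

(** The test function vanishes outside the box, so the values of [u] elsewhere
    in [Omega], where it is not known to be integrable, do not matter. *)
Lemma integral_representative (Omega : set X) (u : X -> R) (gu psi : T -> R) (M : R) :
  tau @^-1` Kt `<=` Omega -> measurable_fun (tau @^-1` Kt) u ->
  lam.-integrable setT (EFin \o gu) ->
  {ae mu, forall x, Kt (tau x) -> gu (tau x) = u x} ->
  measurable_fun setT psi -> (forall t, `|psi t| <= M) -> (forall t, ~ Kt t -> psi t = 0) ->
  \int[mu]_(x in Omega) (u x * psi (tau x)) = \int[lam]_t (gu t * psi t).
Proof.
move=> KO mu_ igu aeu mpsi psiM psi0.
have mtau := @measurable_tuple_of_rV R k.
have igp : lam.-integrable setT (EFin \o (fun t => gu t * psi t)).
  exact: (integrable_mul_bounded (M := M) igu mpsi psiM).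
have [_ e1] := integral_lebesgue_rV igp.
rewrite /Rintegral e1; congr fine.
transitivity (\int[mu]_(x in tau @^-1` Kt) (u x * psi (tau x))%:E)%E.
  rewrite integral_mkcond [RHS]integral_mkcond; apply: eq_integral => x _.
  rewrite !patchE; have [xK|xK] := pselect (Kt (tau x)).
    have xO : Omega x by apply: KO.
    by rewrite !mem_set.
  by rewrite psi0// mulr0; do 2 case: ifP => _.
transitivity (\int[mu]_(x in tau @^-1` Kt) (gu (tau x) * psi (tau x))%:E)%E.
  have m1 : measurable_fun (tau @^-1` Kt) (fun x : X => (u x * psi (tau x))%:E).
    apply/measurable_EFinP; apply: measurable_funM => //.
    by apply: measurable_funTS; exact: measurableT_comp.
  have m2 : measurable_fun (tau @^-1` Kt) (fun x : X => (gu (tau x) * psi (tau x))%:E).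
    apply: measurable_funTS; apply/measurable_EFinP.
    by apply: measurable_funM; apply: measurableT_comp => //; exact: integrable_measurable igu.
  have ae12 : ae_eq mu (tau @^-1` Kt) (fun x : X => (u x * psi (tau x))%:E)
      (fun x : X => (gu (tau x) * psi (tau x))%:E).
    by move: aeu; apply: filterS => x h Kx; rewrite h.
  exact: (@ae_eq_integral _ _ _ mu _ _ _ mK m1 m2 ae12).
rewrite integral_mkcond; apply: eq_integral => x _; rewrite patchE.
by case: ifPn => // /negP; rewrite inE => nK; rewrite /= psi0// mulr0.
Qed.

Lemma derive_support (f f' : R -> R) (a b : R) :
  (forall y : R, is_derive y 1 f (f' y)) -> (forall y, f y != 0 -> a < y < b) ->
  forall y, f' y != 0 -> a <= y <= b.
Proof.
move=> df supp y; apply: contra_neqT => out.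
have E : \forall z \near y, f z = 0.
  move: out; rewrite negb_and -!ltNge => /orP[ya|by_].
    near=> z; have za : z < a by near: z; exact: lt_nbhsl.
    by apply/eqP; apply: contraT => /supp/andP[/(lt_trans za)]; rewrite ltxx.
  near=> z; have bz : b < z by near: z; exact: lt_nbhsr.
  by apply/eqP; apply: contraT => /supp/andP[_ /(lt_trans bz)]; rewrite ltxx.
have E' : \forall z \near y, cst (0 : R) z = f z by apply: filterS E => z ->.
have d0 : is_derive y 1 f 0 := near_eq_is_derive E' (is_derive_cst (0 : R) y (1 : R)).
by have [_ dy0] := d0; have [_ dyf] := df y; rewrite -dyf dy0.
Unshelve. all: end_near. Qed.

(** A product function whose factors are supported in the open box is a test
    function on [Omega], because the closed box is compact. *)
Lemma weak_partial_on_box (Omega : set 'rV[R]_k) (i : 'I_k) (u v : 'rV[R]_k -> R) (gu gv : T -> R) :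
  tau @^-1` Kt `<=` Omega ->
  measurable_fun (tau @^-1` Kt) (u : X -> R) -> measurable_fun (tau @^-1` Kt) (v : X -> R) ->
  lam.-integrable setT (EFin \o gu) -> lam.-integrable setT (EFin \o gv) ->
  {ae mu, forall x, Kt (tau x) -> gu (tau x) = u x} ->
  {ae mu, forall x, Kt (tau x) -> gv (tau x) = v x} ->
  weak_partial Omega i u v -> weak_on_box A B i gu gv.
Proof.
move=> KO mu_ mv igu igv aeu aev wuv g g' sg dg' supp.
have suppw j y : g j y != 0 -> A j <= y <= B j.
  by move=> /supp/andP[h1 h2]; rewrite !ltW.
pose G j := if j == i then g' else g j.
have suppG j y : G j y != 0 -> A j <= y <= B j.
  rewrite /G; have [->|_] := eqVneq j i; last exact: suppw.
  exact: (derive_support dg' (supp i)).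
have [g'' sg'' dg''] := smoothR_derive (sg i).
have g'E : g' = g''.
  by apply/funext => y; have [_ <-] := dg' y; have [_ <-] := dg'' y.
have cg j : continuous (g j) by exact: smoothR_continuous.
have cG j : continuous (G j).
  by rewrite /G; have [_|_] := eqVneq j i; [|exact: cg]; rewrite g'E; exact: smoothR_continuous.
have [mg [M hM] g0] := ttensor_bounded cg suppw.
have [mG [M' hM'] G0] := ttensor_bounded cG suppG.
have Kcompact : compact (tau @^-1` Kt : set 'rV[R]_k).
  have := @compact_closed_box A B; congr compact.
  by apply/seteqP; split => x h j; have := h j; rewrite tnth_mktuple.
have Kclosed : closed (tau @^-1` Kt : set 'rV[R]_k).
  by apply: compact_closed Kcompact; exact: norm_hausdorff.
have sub : closed_support (tensor g) `<=` tau @^-1` Kt.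
  rewrite /closed_support [X in _ `<=` X](closure_id _).1//; apply: closureS.
  move=> x /= gx; apply: contrapT => nK; move/negP: gx; apply.
  by rewrite -ttensor_tau g0.
have test : test_function Omega (tensor g).
  split; first exact: smooth_tensor.
  - apply: (subclosed_compact _ Kcompact) => //; exact: closed_closure.
  - exact: subset_trans sub KO.
have := wuv _ test; rewrite (partial_tensor dg') -/G.
have -> : \int[mu]_(x in Omega) (u x * tensor G x) = \int[lam]_t (gu t * ttensor G t).
  rewrite -(integral_representative KO mu_ igu aeu mG hM' G0).
  by apply: eq_Rintegral => x _; rewrite ttensor_tau.
have -> : \int[mu]_(x in Omega) (v x * tensor g x) = \int[lam]_t (gv t * ttensor g t).
  rewrite -(integral_representative KO mv igv aev mg hM g0).
  by apply: eq_Rintegral => x _; rewrite ttensor_tau.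
move=> <-; apply: eq_Rintegral => t _; congr (_ * _).
rewrite /ttensor [RHS](bigD1 i)//= /G eqxx; congr (_ * _).
by apply: eq_bigr => j /negbTE ->.
Qed.

End bridge.

(** * Isotropic matrices *)

Section isotropic.
Context {R : realType} {k n : nat}.
Local Notation comp := ('I_(2 * n).+1).

Lemma comp_cases (c : comp) :
  [\/ exists l : 'I_n, c = ix l, exists l : 'I_n, c = iy l | c = it].
Proof.
have cn : (c <= 2 * n)%N by rewrite -ltnS.
have [ceq|cne] := eqVneq (c : nat) (2 * n)%N; first by constructor 3; exact/val_inj.
have cln : (c < 2 * n)%N by rewrite ltn_neqAle cne.
have ln : (c./2 < n)%N by rewrite -ltn_double -!muln2 -mulnC; lia.
have e : ((odd c + 2 * c./2)%N = c :> nat) by have := odd_double_half c; rewrite -mul2n.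
case oc : (odd c); [constructor 2|constructor 1]; exists (Ordinal ln); apply/val_inj.
  by rewrite /iy /= inordK; rewrite oc in e; lia.
by rewrite /ix /= inordK; rewrite oc in e; lia.
Qed.

(** The product of [row_mx X Y] with a matrix of the same rank is zero, and the
    inner dimension is [n + n]. *)
Lemma isotropic_rank (X Y : 'M[R]_(k, n)) :
  X *m Y^T = Y *m X^T -> (\rank (row_mx X Y) <= n)%N.
Proof.
move=> XY.
have zero : row_mx X Y *m (row_mx Y (- X))^T = 0.
  by rewrite tr_row_mx mul_row_col linearN /= mulmxN XY subrr.
have Z : row_mx X Y = row_mx Y (- X) *m block_mx 0 1%:M (- 1%:M) 0.
  by rewrite mul_row_block !mulmx0 mulmx1 mulmxN mulNmx mulmx1 opprK add0r addr0.
have le1 : (\rank (row_mx X Y) <= \rank (row_mx Y (- X))^T)%N.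
  by rewrite mxrank_tr {1}Z mxrankM_maxl.
have := mulmx0_rank_max zero; lia.
Qed.

(** A combination of rows that kills the horizontal columns also kills the
    last one, since the contact equation is linear in the row. So the rank is
    that of the horizontal columns. *)
Lemma contact_isotropic_rank (p : 'rV[R]_(2 * n).+1) (M : 'M[R]_(k, (2 * n).+1)) :
  (forall i, contact_form p (row i M) = 0) ->
  (forall i j, area_form (M i) (M j) = 0) -> (\rank M <= n)%N.
Proof.
move=> ctc iso.
pose X := \matrix_(i < k, l < n) M i (ix l).
pose Y := \matrix_(i < k, l < n) M i (iy l).
have XY : X *m Y^T = Y *m X^T.
  apply/matrixP => i j; have := iso i j; rewrite /area_form sumrB => /eqP.
  rewrite subr_eq0 => /eqP h; rewrite !mxE.
  under eq_bigr do rewrite !mxE.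
  by rewrite h; apply: eq_bigr => l _; rewrite !mxE.
apply: leq_trans (isotropic_rank XY).
pose W := kermx (row_mx X Y).
have /eqP : W *m row_mx X Y = 0 by exact: mulmx_ker.
rewrite mul_mx_row row_mx_eq0 => /andP[/eqP WX /eqP WY].
have Wx w l : \sum_i W w i * M i (ix l) = 0.
  have := congr1 (fun N : 'M[R]_(k, n) => N w l) WX; rewrite mxE [RHS]mxE => h; rewrite -[RHS]h.
  by apply: eq_bigr => i _; congr (_ * _); rewrite mxE.
have Wy w l : \sum_i W w i * M i (iy l) = 0.
  have := congr1 (fun N : 'M[R]_(k, n) => N w l) WY; rewrite mxE [RHS]mxE => h; rewrite -[RHS]h.
  by apply: eq_bigr => i _; congr (_ * _); rewrite mxE.
have WM : W *m M = 0.
  apply/matrixP => w c; rewrite !mxE.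
  have [[l ->]|[l ->]|->] := comp_cases c; [exact: Wx|exact: Wy|].
  have Mt i : M i it = - (2 * \sum_(l < n) (p 0 (ix l) * M i (iy l) - p 0 (iy l) * M i (ix l))).
    have /eqP := ctc i; rewrite /contact_form addr_eq0 mxE => /eqP ->.
    by congr (- (2 * _)); apply: eq_bigr => l _; rewrite !mxE.
  under eq_bigr do rewrite Mt mulrN mulrCA mulr_sumr.
  rewrite sumrN -mulr_sumr exchange_big/= big1 ?mulr0 ?oppr0// => l _.
  under eq_bigr do rewrite mulrBr !(mulrCA (W _ _)).
  by rewrite sumrB -!mulr_sumr Wx Wy !mulr0 subrr.
have : (kermx (row_mx X Y) <= kermx M)%MS by apply/sub_kermxP.
move=> /mxrankS; rewrite !mxrank_ker.
have := rank_leq_row M; have := rank_leq_row (row_mx X Y); lia.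
Qed.

End isotropic.

(** * Covering the domain by cubes *)

Section cubes.
Context {R : realType} {k n : nat}.
Local Notation RT := (measurableTypeR R).
Local Notation T := (k.-tuple RT).
Local Notation lam := (@tuple_lebesgue R k).
Local Notation mu := (@lebesgue_rV R k).
Local Notation X := (caratheodory_type (@lebesgue_outer R k)).
Local Notation tau := (@tuple_of_rV R k : X -> T).

Lemma rank_on_box (Omega : set 'rV[R]_k) (f : 'rV[R]_k -> 'rV[R]_(2 * n).+1)
    (Df : 'rV[R]_k -> 'M[R]_(k, (2 * n).+1)) (a b : 'I_k -> R) (h : R) :
  (forall c, locally_integrable_rV Omega (fun x => f x 0 c)) ->
  weak_derivative Omega f Df ->
  {ae mu, forall x, Omega x ->
       range (fun v : 'rV[R]_k => v *m Df x) `<=` contact_kernel (f x)} ->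
  0 < h -> (forall j, a j <= b j) ->
  tau @^-1` closed_box a (fun j => b j + h + h + h) `<=` Omega ->
  {ae mu, forall x, box a b (tau x) -> (\rank (Df x) <= n)%N}.
Proof.
move=> fi fDf ctc h0 ab KO.
pose B j := b j + h + h + h.
have bB j : b j <= B j by rewrite /B -!addrA lerDl !addr_ge0// ltW.
have AB j : a j <= B j by exact: le_trans (ab j) (bB j).
have mKt : measurable (closed_box a B : set T) by exact: measurable_closed_box.
have Koo := closed_box_lty AB.
have Kcompact : compact (tau @^-1` closed_box a B : set 'rV[R]_k).
  have := compact_closed_box (A := a) (B := B); congr compact.
  by apply/seteqP; split => x hx j; have := hx j; rewrite tnth_mktuple.
have repU c := borel_representative mKt Koo (fi c _ Kcompact KO).
have repV i c := borel_representative mKt Koo ((fDf i c).1 _ Kcompact KO).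
have [U hU] := choice repU.
have repV' i := choice (repV i).
have [V hV] : exists V : 'I_k -> 'I_(2 * n).+1 -> T -> R, forall i c,
    [/\ lam.-integrable setT (EFin \o V i c),
      {ae mu, forall x, closed_box a B (tau x) -> V i c (tau x) = Df x i c} &
      forall t, ~ closed_box a B t -> V i c t = 0].
  by exists (fun i => projT1 (repV' i)) => i; exact: (projT2 (repV' i)).
have iU c : lam.-integrable setT (EFin \o U c) by have [] := hU c.
have iV i c : lam.-integrable setT (EFin \o V i c) by have [] := hV i c.
have mf c : measurable_fun (tau @^-1` closed_box a B) (fun x : X => f x 0 c).
  by apply/measurable_EFinP; exact: (measurable_int mu (fi c _ Kcompact KO)).
have mDf i c : measurable_fun (tau @^-1` closed_box a B) (fun x : X => Df x i c).
  by apply/measurable_EFinP; exact: (measurable_int mu ((fDf i c).1 _ Kcompact KO)).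
have UV i c : weak_on_box a B i (U c) (V i c).
  have [_ aeU _] := hU c; have [_ aeV _] := hV i c.
  exact: (weak_partial_on_box KO (mf c) (mDf i c) (iU c) (iV i c) aeU aeV (fDf i c).2).
have aeU : {ae mu, forall x c, closed_box a B (tau x) -> U c (tau x) = f x 0 c}.
  by apply: filter_forall => c; have [] := hU c.
have aeV : {ae mu, forall x i c, closed_box a B (tau x) -> V i c (tau x) = Df x i c}.
  by apply: filter_forall => i; apply: filter_forall => c; have [] := hV i c.
have aeC : {ae mu, forall x, closed_box a B (tau x) -> forall i, contact_form (f x) (row i (Df x)) = 0}.
  move: ctc; apply: (@filterS _ _ (ae_filter_ringOfSetsType mu)) => x hx Kx i; apply: (hx (KO _ Kx)).
  by exists (delta_mx 0 i) => //; rewrite -rowE.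
have aeUV : {ae mu, forall x, closed_box a B (tau x) -> forall i, contact_at U V i (tau x)}.
  apply: filterS3 aeU aeV aeC => x hu hv hc Kx i.
  have := hc Kx i; rewrite /contact_form /contact_at mxE hv// => h1; rewrite -[RHS]h1.
  congr (_ + 2 * _); apply: eq_bigr => l _.
  by rewrite !hu// !hv// !mxE.
have aeB : {ae lam, forall t, box a B t -> forall i, contact_at U V i t}.
  have := ae_tuple_lebesgue aeUV; apply: (@filterS _ _ (ae_filter_ringOfSetsType lam)) => t; rewrite tuple_of_rVK => ht Bt.
  by apply: ht => j; have /andP[h1 h2] := Bt j; rewrite !ltW.
have vanish := area_form_vanishes iU iV UV aeB h0 h0 (fun j => lexx (a j)) ab (fun j => lexx _).
have := ae_lebesgue_rV vanish.
apply: filterS3 aeV aeC => x hv hc hx bx.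
have Kx : closed_box a B (tau x).
  by move=> j; have /andP[h1 h2] := bx j; rewrite ltW//= (le_trans (ltW h2)).
apply: contact_isotropic_rank (hc Kx) _ => i j.
rewrite -(hx bx i j) /area_form; apply: eq_bigr => l _.
by rewrite !hv.
Qed.

End cubes.

Lemma grid_distance (R : realType) (q h x y e : R) : 0 < h -> 5 * h <= e ->
  q * h <= x < (q + 1) * h -> (q - 1) * h <= y <= (q + 1) * h + h + h + h -> `|x - y| < e.
Proof.
rewrite !mulrDl mulNr !mul1r => h0 he /andP[x1 x2] /andP[y1 y2].
by rewrite ltr_norml; apply/andP; split; lra.
Qed.

Unset Implicit Arguments.

Theorem theorem1p4 (R : realType) (n k : nat) (n_gt0 : (0 < n)%N)
    (n_lt_k : (n < k)%N) (Omega : set 'rV[R]_k) (Omega_open : open Omega)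
    (f : 'rV[R]_k -> 'rV[R]_(2 * n).+1) (f_W11 : W11loc Omega f)
    (Df : 'rV[R]_k -> 'M[R]_(k, (2 * n).+1))
    (f_Df : weak_derivative Omega f Df)
    (f_contact : {ae lebesgue_rV, forall x, Omega x ->
       range (fun v : 'rV[R]_k => v *m Df x) `<=` contact_kernel (f x)}) :
  {ae lebesgue_rV, forall x, Omega x -> (\rank (Df x) <= n)%N}.
Proof.
pose index : Type := (nat * {ffun 'I_k -> int})%type.
pose h (p : index) : R := p.1.+1%:R^-1.
(* The cube is wider than a cell of the grid by one step on either side of
   its lower corner, so that every point lies in the open cube of its cell. *)
pose a (p : index) (j : 'I_k) : R := (p.2 j - 1)%:~R * h p.
pose b (p : index) (j : 'I_k) : R := (p.2 j + 1)%:~R * h p.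
have h0 p : 0 < h p by rewrite invr_gt0 ltr0n.
have ab p j : a p j <= b p j.
  by rewrite ler_wpM2r ?(ltW (h0 p))// ler_int; lia.
pose inside (p : index) := @tuple_of_rV R k @^-1`
  closed_box (a p) (fun j => b p j + h p + h p + h p) `<=` Omega.
have aep p : {ae lebesgue_rV, forall x, inside p -> box (a p) (b p) (tuple_of_rV x) ->
    (\rank (Df x) <= n)%N}.
  have [ins|nins] := pselect (inside p); last by apply: aeW => x /nins.
  have := rank_on_box f_W11.1 f_Df f_contact (h0 p) (ab p) ins.
  by apply: filterS => x hx _.
have ae_all : {ae lebesgue_rV, forall x (m : nat),
    if unpickle m is Some p then inside p -> box (a p) (b p) (@tuple_of_rV R k x) ->
      (\rank (Df x) <= n)%N else True}.
  apply: ae_foralln => m; case: (unpickle m) => [p|]; first exact: aep.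
  exact: aeW.
move: ae_all; apply: (@filterS _ _ (ae_filter_ringOfSetsType (@lebesgue_rV R k))) => x hx Ox.
have [e /= e0 sub] := (nbhs_ballP _ _).1 (Omega_open _ Ox).
(* A closed cube with its margin of three steps has side [5 * h p]. *)
pose N := Num.truncn (5 / e).
pose p : index := (N, [ffun j => Num.floor (x 0 j * N.+1%:R)]).
have N0 : 0 < N.+1%:R :> R by rewrite ltr0n.
have eN : 5 * h p <= e.
  by rewrite /h/= ler_pdivrMr// mulrC -ler_pdivrMr//; apply: ltW; exact: truncnS_gt.
have xfloor j : (p.2 j)%:~R * h p <= x 0 j < (p.2 j + 1)%:~R * h p.
  rewrite /h /p/= ffunE ler_pdivrMr// ltr_pdivlMr//.
  by rewrite floor_le_tmp floorD1_gt.
have xbox j : a p j < x 0 j < b p j.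
  have /andP[h1 ->] := xfloor j; rewrite andbT; apply: lt_le_trans h1.
  by rewrite /a ltr_pM2r// ltr_int; lia.
have := hx (pickle p); rewrite pickleK; apply; last first.
  by move=> j; rewrite tnth_mktuple.
move=> y hy; apply: sub; split => // i j; rewrite ord1.
have := hy j; have := xfloor j; rewrite tnth_mktuple /a /b.
rewrite !intrD /ball/= => hxj hyj.
exact: grid_distance (h0 p) eN hxj hyj.
Qed.
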